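(* Let $b>a$ be positive integers and $p>0$. There exists an $(\mathrm{L}^p,\mathrm{L}^0)$ measure equivalence coupling from $\mathbb{Z}^b$ to $\mathbb{Z}^a$ if and only if $p<a/b$.
   Context: Measure equivalence coupling between countable groups $\Gamma,\Lambda$: a quadruple $(\Omega,X_\Gamma,X_\Lambda,\mu)$ where $(\Omega,\mu)$ is a standard Borel measure space with commuting, free, measure-preserving actions $\gamma\ast x$, $\lambda\ast x$ of $\Gamma$ and $\Lambda$, and $X_\Gamma$ (resp. $X_\Lambda$) is a Borel fundamental domain of finite measure for the $\Gamma$-action (resp. $\Lambda$-action). For $\gamma\in\Gamma$, $x\in X_\Lambda$, $\gamma\cdot x$ is the unique point of $(\Lambda\ast\gamma\ast x)\cap X_\Lambda$ and the cocycle $c_{\Lambda,\Gamma}\colon\Gamma\times X_\Lambda\to\Lambda$ is defined by $c_{\Lambda,\Gamma}(\gamma,x)\ast\gamma\ast x=\gamma\cdot x$. An $(\mathrm{L}^p,\mathrm{L}^0)$ measure equivalence coupling from $\Gamma$ to $\Lambda$ is one where, for every $\gamma\in\Gamma$, $x\mapsto|c_{\Lambda,\Gamma}(\gamma,x)|_{S_\Lambda}$ lies in $\mathrm{L}^p(X_\Lambda,\mu)$ ($|\cdot|_{S_\Lambda}$ the word length for a finite generating set of $\Lambda$); no requirement is made on the other cocycle. *)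

(* Defs.v *)
From HB Require Import structures.
From mathcomp Require Import all_boot all_order all_algebra.
From mathcomp Require Import all_classical all_reals all_analysis.
Set Implicit Arguments. Unset Strict Implicit. Unset Printing Implicit Defensive.
Import Order.TTheory GRing.Theory Num.Theory.
Local Open Scope classical_set_scope.
Local Open Scope ring_scope.

Notation Zn n := 'rV[int]_n.

(* Word length on Z^n w.r.t. the standard finite generating set
   {±e_1, ..., ±e_n}: the l^1 norm. *)
Definition wordlen (n : nat) (v : Zn n) : nat := (\sum_(i < n) `|v ord0 i|)%N.

(* Standard Borel space: Borel isomorphic to a Borel subset of the reals
   (Kuratowski), i.e. there is an injection into R with Borel range such
   that the measurable sets are exactly those with Borel image. *)
Definition standard_borel (R : realType) (d : measure_display)
    (T : measurableType d) : Prop :=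
  exists f : T -> R, injective f /\ measurable (range f) /\
    forall A : set T, measurable A <-> measurable (f @` A).

Definition mp_free_action (R : realType) (d : measure_display)
    (T : measurableType d) (mu : {measure set T -> \bar R}) (n : nat)
    (act : Zn n -> T -> T) : Prop :=
  [/\ (forall x, act 0 x = x),
      (forall g h x, act (g + h) x = act g (act h x)),
      (forall g, measurable_fun setT (act g)),
      (forall g A, measurable A -> mu (act g @^-1` A) = mu A) &
      (forall g x, act g x = x -> g = 0)].

Definition fund_domain (d : measure_display) (T : measurableType d) (n : nat)
    (act : Zn n -> T -> T) (X : set T) : Prop :=
  measurable X /\ forall x, exists! g, X (act g x).

(* The cocycle c_{Lambda,Gamma}(g, x): the unique l in Lambda with
   l * g * x in X_Lambda (for x in X_Lambda). *)
Definition cocycle (d : measure_display) (T : measurableType d) (m n : nat)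
    (actG : Zn m -> T -> T) (actL : Zn n -> T -> T) (XL : set T)
    (g : Zn m) (x : T) : Zn n :=
  xget 0 [set l | XL (actL l (actG g x))].

Definition LpL0_coupling (R : realType) (p : R) (m n : nat)
    (d : measure_display) (T : measurableType d) (mu : {measure set T -> \bar R})
    (actG : Zn m -> T -> T) (actL : Zn n -> T -> T) (XG XL : set T) : Prop :=
  [/\ (standard_borel R T /\ (0 < mu setT)%E),
      (mp_free_action mu actG /\ mp_free_action mu actL),
      (forall g l x, actG g (actL l x) = actL l (actG g x)),
      [/\ fund_domain actG XG, (mu XG < +oo)%E,
           fund_domain actL XL & (mu XL < +oo)%E] &
      forall g : Zn m, mu.-integrable XL
        (fun x => (((wordlen (cocycle actG actL XL g x))%:R : R) `^ p)%:E)].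

Definition exists_LpL0_coupling (R : realType) (p : R) (m n : nat) : Prop :=
  exists (d : measure_display) (T : measurableType d)
         (mu : {measure set T -> \bar R})
         (actG : Zn m -> T -> T) (actL : Zn n -> T -> T) (XG XL : set T),
    LpL0_coupling p mu actG actL XG XL.

(* Main.v *)
Require Import Defs.
From HB Require Import structures.
From mathcomp Require Import all_boot all_order all_algebra.
From mathcomp Require Import all_classical all_reals all_analysis measurable_realfun.
From mathcomp Require Import ring lra zify.
Set Implicit Arguments. Unset Strict Implicit. Unset Printing Implicit Defensive.
Import Order.TTheory GRing.Theory Num.Theory.
Local Open Scope classical_set_scope.
Local Open Scope ring_scope.

(** Non-existence.  Let [p = a / b < 1] and let [displ g x] be the length of the
    cocycle.  Since [t |-> t^p] is subadditive, the integral of [(displ g)^p]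
    grows at most linearly in [|g|]; truncating the displacements of the
    generators at a large [M] and using [p < 1] shows that it is in fact
    [o(|g|)].  Hence for most [g] in a box of side [n] the displacement of most
    points is [o(n^(b/a))].  But on a set [Y] of positive measure whose
    [Z^b]-translates are disjoint, at most [(2r+1)^a mu(X) / mu(Y)] elements [g] of
    the box can displace by at most [r] on average, and this is much smaller than
    [n^b] when [r] is a small multiple of [n^(b/a)].

    Existence.  On the binary sequences, [Z^n] acts by the odometer obtained by
    splitting a sequence into its [n] subsequences of digits along the residue
    classes modulo [n] and adding an integer to each of them as a 2-adic number.
    Outside a null set the orbits of the [Z^a]- and [Z^b]-odometers are both the
    classes of equality of tails.  A fixed element of [Z^b] changes more than [mb]
    digits with probability [O(2^-m)], and changing [mb] digits is a move of
    length [O(2^(mb/a))] in [Z^a]; the [p]-th moment is finite as soon as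
    [p b / a < 1].  Sequences are realized as binary expansions of points of
    [[0, 1)], so that all the actions are piecewise translations of the line. *)

(** * Countable partitions and integrals *)

(** Functions into a countable type are handled through their fibres alone, so that no sigma-algebra
    has to be chosen on that type. *)
Lemma measurable_preimage_pred (d : measure_display) (T : measurableType d)
    (I : countType) (c : T -> I) (D : set T) (P : set I) :
  (forall i, measurable (D `&` c @^-1` [set i])) -> measurable (D `&` c @^-1` P).
Proof.
move=> mc.
have -> : D `&` c @^-1` P =
    \bigcup_i (if `[<P i>] then D `&` c @^-1` [set i] else set0).
  apply/seteqP; split => [x [Dx Px]|x [i _]].
    by exists (c x) => //; case: asboolP.
  by case: asboolP => // Pi [Dx /= ci]; split=> //=; rewrite ci.
apply: countable_bigcupT_measurable => [|i]; first exact: countableP.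
by case: asboolP.
Qed.

Lemma measurable_fun_countable (d d' : measure_display) (T : measurableType d)
    (U : measurableType d') (I : countType) (c : T -> I) (D : set T) (u : I -> U) :
  (forall i, measurable (D `&` c @^-1` [set i])) ->
  measurable_fun D (fun x => u (c x)).
Proof. by move=> mc _ B _; exact: (measurable_preimage_pred (u @^-1` B) mc). Qed.

Lemma measurable_preimage2 (d : measure_display) (T : measurableType d)
    (I J K : countType) (c : T -> I) (e : T -> J) (u : I -> J -> K) :
  (forall i, measurable (c @^-1` [set i])) ->
  (forall j, measurable (e @^-1` [set j])) ->
  forall k, measurable ((fun x => u (c x) (e x)) @^-1` [set k]).
Proof.
move=> mc me k.
have := @measurable_preimage_pred _ _ (I * J)%type (fun x => (c x, e x)) setT
  [set ij | u ij.1 ij.2 = k].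
rewrite !setTI; apply => -[i j]; rewrite setTI.
have -> : (fun x => (c x, e x)) @^-1` [set (i, j)] =
    c @^-1` [set i] `&` e @^-1` [set j].
  by apply/seteqP; split => [x /= [-> ->]|x /= [-> ->]].
exact: measurableI.
Qed.

Lemma ge0_integral_partition (d : measure_display) (T : measurableType d)
    (R : realType) (mu : {measure set T -> \bar R}) (D : set T) (c : T -> nat)
    (f : T -> \bar R) :
  (forall n, measurable (D `&` c @^-1` [set n])) -> measurable_fun D f ->
  (forall x, D x -> (0 <= f x)%E) ->
  (\int[mu]_(x in D) f x =
   \sum_(0 <= n <oo) \int[mu]_(x in D `&` c @^-1` [set n]) f x)%E.
Proof.
move=> mc mf f0.
have DE : D = \bigcup_n (D `&` c @^-1` [set n]).
  by apply/seteqP; split => [x Dx|x [n _ []//]]; exists (c x).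
rewrite {1}DE ge0_integral_bigcup // -?DE //.
apply/trivIsetP => i j _ _ ij; apply/seteqP; split => // x [[_ /= xi] [_ /= xj]].
by move: ij; rewrite -xi -xj eqxx.
Qed.

Lemma ge0_integral_mp (d : measure_display) (T : measurableType d)
    (R : realType) (mu : {measure set T -> \bar R}) (phi : T -> T) (D : set T)
    (f : T -> \bar R) :
  measurable_fun setT phi ->
  (forall A, measurable A -> mu (phi @^-1` A) = mu A) ->
  measurable D -> measurable_fun D f -> (forall x, (0 <= f x)%E) ->
  (\int[mu]_(x in phi @^-1` D) f (phi x) = \int[mu]_(x in D) f x)%E.
Proof.
move=> mphi mpphi mD mf f0.
rewrite -(ge0_integral_pushforward mphi mu mD mf) //.
by apply: eq_measure_integral => A mA _; exact: mpphi.
Qed.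

(** A ratio [t = z / (x + y)] lies in [[0, 1]], where [t <= t^p] because [p <= 1]. Adding this for
    [z = x] and [z = y], whose ratios sum to 1, gives the claim. *)
Lemma powR_subadd (R : realType) (x y p : R) :
  0 <= x -> 0 <= y -> 0 < p <= 1 -> (x + y) `^ p <= x `^ p + y `^ p.
Proof.
move=> x0 y0 /andP[p0 p1]; have [s0|s0] := eqVneq (x + y) 0.
  by rewrite s0 powR0 ?gt_eqF// addr_ge0// powR_ge0.
have sgt0 : 0 < x + y by rewrite lt_neqAle eq_sym s0 addr_ge0.
have key z : 0 <= z -> z <= x + y -> z / (x + y) * (x + y) `^ p <= z `^ p.
  move=> z0 zs; have [->|zn0] := eqVneq z 0; first by rewrite !mul0r powR_ge0.
  have -> : z `^ p = (z / (x + y)) `^ p * (x + y) `^ p.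
    by rewrite -powRM ?divr_ge0 ?(ltW sgt0) // divfK.
  apply: ler_wpM2r; first exact: powR_ge0.
  have zp : 0 < z by rewrite lt_neqAle eq_sym zn0.
  rewrite -[leLHS]powRr1 ?divr_ge0 ?(ltW sgt0) //; apply: ger_powR => //.
  by rewrite divr_gt0 //= ler_pdivrMr// mul1r.
have := lerD (key _ x0 _) (key _ y0 _); rewrite lerDl lerDr => /(_ y0 x0).
by rewrite -mulrDl -mulrDl divff // mul1r.
Qed.

Lemma measure_gt0_level (d : measure_display) (T : measurableType d)
    (R : realType) (mu : {measure set T -> \bar R}) (I : countType) (c : T -> I)
    (D : set T) :
  measurable D -> (forall i, measurable (D `&` c @^-1` [set i])) ->
  (0 < mu D)%E -> exists i, (0 < mu (D `&` c @^-1` [set i]))%E.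
Proof.
move=> mD mc muD; apply: contrapT => no.
have c0 i : mu (D `&` c @^-1` [set i]) = 0%E.
  by apply/eqP/negPn/negP => ci; apply: no; exists i; rewrite lt0e ci measure_ge0.
suff : (mu D <= 0)%E by move=> /(lt_le_trans muD); rewrite ltxx.
have mF k : measurable (D `&` (fun x => pickle (c x)) @^-1` [set k]).
  exact: (@measurable_preimage_pred _ _ _ c D [set i | pickle i = k]).
apply: (le_trans (measure_sigma_subadditive mu mF mD _)) => [x Dx|].
  by exists (pickle (c x)).
rewrite eseries0 // => k _ _.
have [[i <-]|nl] := pselect (exists i : I, pickle i = k); last first.
  rewrite (_ : _ `&` _ = set0) ?measure0 //.
  by apply/seteqP; split => // x [_ /= xk]; apply: nl; exists (c x).
rewrite -[RHS](c0 i); congr (mu _); apply/seteqP; split => x [Dx /=].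
  by move=> /(pcan_inj pickleK).
by move=> ->.
Qed.

(** * Fundamental domains and induced actions *)

Lemma wordlen0 (n : nat) : wordlen (0 : Zn n) = 0%N.
Proof. by apply: big1 => i _; rewrite mxE. Qed.

Lemma wordlenD (n : nat) (u v : Zn n) : (wordlen (u + v) <= wordlen u + wordlen v)%N.
Proof.
rewrite /wordlen -big_split /=; apply: leq_sum => i _; rewrite mxE.
by move: (u ord0 i) (v ord0 i) => x y; lia.
Qed.

Lemma wordlen_coord (n : nat) (u : Zn n) (i : 'I_n) : (`|u ord0 i| <= wordlen u)%N.
Proof. by rewrite /wordlen (bigD1 i) //= leq_addr. Qed.

Section FundamentalDomain.
Variables (R : realType) (d : measure_display) (T : measurableType d).
Variables (mu : {measure set T -> \bar R}) (n : nat) (act : Zn n -> T -> T).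
Variable X : set T.
Hypothesis act_mp : mp_free_action mu act.
Hypothesis XD : fund_domain act X.

Lemma act_id x : act 0 x = x. Proof. by case: act_mp => + _ _ _ _; apply. Qed.

Lemma act_add g h x : act (g + h) x = act g (act h x).
Proof. by case: act_mp => _ + _ _ _; apply. Qed.

Lemma actK g x : act (- g) (act g x) = x.
Proof. by rewrite -act_add addNr act_id. Qed.

Lemma act_measurable g : measurable_fun setT (act g).
Proof. by case: act_mp => _ _ + _ _; apply. Qed.

Lemma act_preserves g A : measurable A -> mu (act g @^-1` A) = mu A.
Proof. by case: act_mp => _ _ _ + _; apply. Qed.

Lemma act_preimage_measurable g A : measurable A -> measurable (act g @^-1` A).
Proof. by move=> mA; rewrite -[_ @^-1` _]setTI; exact: act_measurable. Qed.

(** At the point [actG g x] this is the cocycle of the coupling. Being defined on all of [T], it is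
    an equivariant map to [Z^n] whose fibres are the translates of [X]. *)
Definition return_elt (x : T) : Zn n := xget 0 [set l | X (act l x)].

Lemma return_eltP x : X (act (return_elt x) x).
Proof.
have [g [Xg _]] := XD.2 x.
by rewrite /return_elt; case: xgetP => [l _ //|/(_ g)].
Qed.

Lemma return_elt_uniq l x : X (act l x) -> return_elt x = l.
Proof.
have [g [_ gu]] := XD.2 x => Xl.
by rewrite -(gu _ Xl) -(gu _ (return_eltP x)).
Qed.

Lemma return_elt_preimage l : return_elt @^-1` [set l] = act l @^-1` X.
Proof.
apply/seteqP; split => [x /= <-|x /=]; first exact: return_eltP.
exact: return_elt_uniq.
Qed.

Lemma return_elt_measurable l : measurable (return_elt @^-1` [set l]).
Proof. by rewrite return_elt_preimage; apply: act_preimage_measurable; case: XD. Qed.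

Lemma return_elt_act l x : return_elt (act l x) = return_elt x - l.
Proof.
by apply: return_elt_uniq; rewrite -act_add subrK; exact: return_eltP.
Qed.

Lemma return_elt_in x : X x -> return_elt x = 0.
Proof. by move=> Xx; apply: return_elt_uniq; rewrite act_id. Qed.

Lemma fund_domain_gt0 : (0 < mu setT)%E -> (0 < mu X)%E.
Proof.
move=> muT.
have [|l] := @measure_gt0_level _ _ _ mu _ return_elt setT measurableT _ muT.
  by move=> l; rewrite setTI; exact: return_elt_measurable.
by rewrite setTI return_elt_preimage act_preserves //; case: XD.
Qed.

End FundamentalDomain.

Section Induced.
Variables (R : realType) (d : measure_display) (T : measurableType d).
Variables (mu : {measure set T -> \bar R}) (m n : nat).
Variables (actG : Zn m -> T -> T) (actL : Zn n -> T -> T) (X : set T).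
Hypothesis G_mp : mp_free_action mu actG.
Hypothesis L_mp : mp_free_action mu actL.
Hypothesis actC : forall g l x, actG g (actL l x) = actL l (actG g x).
Hypothesis XD : fund_domain actL X.

Local Notation pi := (return_elt actL X).

(* The integral over [X] of an invariant function is an integral over the
   quotient by [actL], on which [actG] acts preserving the measure. *)
Lemma integral_invariant_act (f : T -> \bar R) (g : Zn m) :
  measurable_fun setT f -> (forall x, (0 <= f x)%E) ->
  (forall l x, f (actL l x) = f x) ->
  (\int[mu]_(x in X) f (actG g x) = \int[mu]_(x in X) f x)%E.
Proof.
move=> mf f0 fL; have mX : measurable X := XD.1.
have mpi k l : measurable ((fun x => pi (actG k x)) @^-1` [set l]).
  exact: (act_preimage_measurable G_mp k (return_elt_measurable L_mp XD l)).
have mc (J : countType) k (u : Zn n -> J) j :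
    measurable (X `&` (fun x => u (pi (actG k x))) @^-1` [set j]).
  apply: (@measurable_preimage_pred _ _ _ (fun x => pi (actG k x)) X (u @^-1` [set j])).
  by move=> i; apply: measurableI.
(* Cut [X] according to the element [l] that brings [actG g x] back to [X]. On such a piece
   [x |-> l g x] preserves the measure, and its image is the piece of [X] where
   [- pi (actG (- g) y) = l]. As [f] does not see [l], the two integrals agree piece by piece. *)
rewrite (@ge0_integral_partition _ _ _ mu X (fun x => pickle (pi (actG g x)))) //.
- rewrite [RHS](@ge0_integral_partition _ _ _ mu X
    (fun x => pickle (- pi (actG (- g) x)))) //.
  + apply: eq_eseriesr => k _.
    have [[l <-]|nl] := pselect (exists l : Zn n, pickle l = k); last first.
      have E0 (h : T -> Zn n) : X `&` (fun x => pickle (h x)) @^-1` [set k] = set0.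
        by apply/seteqP; split => // x [_ /= xk]; apply: nl; exists (h x).
      by rewrite (E0 (fun x => - pi (actG (- g) x))) E0 !integral_set0.
    pose D := X `&` (fun x => pickle (- pi (actG (- g) x))) @^-1` [set pickle l].
    pose phi x := actL l (actG g x).
    have DE : X `&` (fun x => pickle (pi (actG g x))) @^-1` [set pickle l] =
        phi @^-1` D.
      apply/seteqP; split => [x [Xx /= /(pcan_inj pickleK) xl]|x [Xx /= xl]].
        split; first by rewrite /phi -xl; exact: (return_eltP XD).
        rewrite /= /phi actC (actK G_mp) (return_elt_act L_mp XD).
        by rewrite (return_elt_in L_mp XD) // sub0r opprK.
      move: xl => /(pcan_inj pickleK).
      rewrite /phi actC (actK G_mp) (return_elt_act L_mp XD) opprB => xl.
      have pix0 : pi x = 0 by apply/eqP; rewrite -oppr_eq0 -(inj_eq (addrI l)) addr0 xl.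
      split; first by rewrite -(act_id L_mp x) -pix0; exact: (return_eltP XD).
      by rewrite /= (return_elt_uniq XD Xx).
    rewrite DE -/D -(@ge0_integral_mp _ _ _ mu phi D f).
    * by apply: eq_integral => x _; rewrite /phi fL.
    * apply: (@measurableT_comp _ _ _ _ _ _ (actL l) _ (actG g)).
        exact: (act_measurable L_mp).
      exact: (act_measurable G_mp).
    * move=> A mA; rewrite -[RHS](act_preserves L_mp l mA).
      exact: (act_preserves G_mp g (act_preimage_measurable L_mp l mA)).
    * exact: (mc _ _ (fun l => pickle (- l))).
    * exact: measurable_funTS.
    * exact: f0.
  + exact: (mc _ _ (fun l => pickle (- l))).
  + exact: measurable_funTS.
- apply: measurable_funTS; apply: (measurableT_comp mf).
  exact: (act_measurable G_mp).
Qed.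

End Induced.

(** * Moments of integer-valued functions *)

Section NatPower.
Variables (R : realType) (d : measure_display) (T : measurableType d).
Variables (mu : {measure set T -> \bar R}) (X : set T) (p : R).
Hypotheses (mX : measurable X) (p0 : 0 < p).

Definition npow (V : T -> nat) (x : T) : \bar R := (((V x)%:R : R) `^ p)%:E.

Definition level_measurable (V : T -> nat) : Prop :=
  forall k, measurable (V @^-1` [set k]).

Lemma npow_ge0 V x : (0 <= npow V x)%E.
Proof. by rewrite lee_fin powR_ge0. Qed.

Lemma npow_measurable V : level_measurable V -> measurable_fun setT (npow V).
Proof.
move=> mV.
apply: (@measurable_fun_countable _ _ _ _ nat V setT (fun k => ((k%:R : R) `^ p)%:E)).
by move=> k; rewrite setTI; exact: mV.
Qed.

Lemma npow_le V W x : (V x <= W x)%N -> (npow V x <= npow W x)%E.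
Proof.
move=> VW; rewrite lee_fin; apply: ge0_ler_powR; rewrite ?nnegrE //; first exact: ltW.
by rewrite ler_nat.
Qed.

Lemma integral_npow_le V W : level_measurable V -> level_measurable W ->
  (forall x, X x -> (V x <= W x)%N) ->
  (\int[mu]_(x in X) npow V x <= \int[mu]_(x in X) npow W x)%E.
Proof.
move=> mV mW VW; apply: ge0_le_integral => //.
- by move=> x _; exact: npow_ge0.
- exact/measurable_funTS/npow_measurable.
- exact/measurable_funTS/npow_measurable.
- by move=> x /VW; exact: npow_le.
Qed.

Definition excess (M : nat) (V : T -> nat) (x : T) : nat := ((M < V x) * V x)%N.

Lemma excess_measurable M V : level_measurable V -> level_measurable (excess M V).
Proof.
move=> mV k; rewrite -[_ @^-1` _]setTI.
apply: (@measurable_preimage_pred _ _ _ V setT [set v | ((M < v) * v)%N = k]).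
by move=> i; rewrite setTI; exact: mV.
Qed.

(** At each point the excess vanishes as soon as [M] reaches [V x], and it is dominated by [V];
    dominated convergence applies. *)
Lemma excess_small V (eps : R) : level_measurable V -> 0 < eps ->
  (\int[mu]_(x in X) npow V x < +oo)%E ->
  exists M, (\int[mu]_(x in X) npow (excess M V) x <= eps%:E)%E.
Proof.
move=> mV eps0 Vfin.
have iV : mu.-integrable X (npow V).
  apply/integrableP; split; first exact/measurable_funTS/npow_measurable.
  by under eq_integral do rewrite gee0_abs ?npow_ge0 //.
have mE M : measurable_fun X (npow (excess M V)).
  exact/measurable_funTS/npow_measurable/excess_measurable.
have cE : {ae mu, forall x, X x -> npow (excess M V) x @[M --> \oo] --> (0 : \bar R)%E}.
  apply/aeW => x _; apply: cvg_near_cst; exists (V x) => // n /= Vn.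
  by rewrite /npow /excess ltnNge Vn mul0n powR0 // gt_eqF.
have bE : {ae mu, forall x M, X x -> (`|npow (excess M V) x| <= npow V x)%E}.
  apply/aeW => x n _; rewrite gee0_abs ?npow_ge0 //; apply: npow_le.
  by rewrite /excess; case: (_ < _)%N; rewrite ?mul1n ?mul0n.
have [_ _] := dominated_convergence mX mE (measurable_cst _) cE iV bE.
rewrite integral0 => /fine_cvgP[Hf /cvgrPdist_le /(_ _ eps0) He].
have [N _ HN] := Hf; have [N' _ HN'] := He.
exists (maxn N N').
have /= := HN (maxn N N') (leq_maxl _ _); have /= := HN' (maxn N N') (leq_maxr _ _).
rewrite sub0r normrN => h1 h2; rewrite -(fineK h2) lee_fin.
exact: le_trans (ler_norm _) h1.
Qed.

Lemma integral_npowD V W : p <= 1 -> level_measurable V -> level_measurable W ->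
  (\int[mu]_(x in X) npow (fun x => V x + W x)%N x <=
   \int[mu]_(x in X) npow V x + \int[mu]_(x in X) npow W x)%E.
Proof.
move=> p1 mV mW; rewrite -ge0_integralD //; last first.
- exact/measurable_funTS/npow_measurable.
- by move=> x _; exact: npow_ge0.
- exact/measurable_funTS/npow_measurable.
- by move=> x _; exact: npow_ge0.
apply: ge0_le_integral => //.
- by move=> x _; exact: npow_ge0.
- apply/measurable_funTS/npow_measurable.
  exact: (@measurable_preimage2 _ _ nat nat nat V W addn).
- by apply: emeasurable_funD; exact/measurable_funTS/npow_measurable.
- move=> x _; rewrite -EFinD lee_fin natrD; apply: powR_subadd => //.
  by rewrite p0.
Qed.

(** Markov's inequality; for integer values, exceeding [r] means being at least [r.+1]. *)
Lemma npow_markov V r : level_measurable V ->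
  (((r.+1)%:R `^ p)%:E * mu (X `&` [set x | (r < V x)%N]) <=
     \int[mu]_(x in X) npow V x)%E.
Proof.
move=> mV.
have mr : measurable (X `&` [set x | (r < V x)%N]).
  apply: measurableI => //; rewrite -[X in measurable X]setTI.
  apply: (@measurable_preimage_pred _ _ _ V setT [set v | (r < v)%N]).
  by move=> i; rewrite setTI; exact: mV.
rewrite -integral_cst //.
apply: (@le_trans _ _ (\int[mu]_(x in X `&` [set x | (r < V x)%N]) npow V x)%E).
  apply: ge0_le_integral => //.
  - by move=> x _; rewrite lee_fin powR_ge0.
  - exact/measurable_funTS/npow_measurable.
  - move=> x [_ /= rV]; rewrite lee_fin; apply: ge0_ler_powR; rewrite ?nnegrE //.
      exact: ltW.
    by rewrite ler_nat.
apply: ge0_subset_integral => //.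
  exact/measurable_funTS/npow_measurable.
by move=> x _; exact: npow_ge0.
Qed.

End NatPower.

(** * Displacement growth *)

Lemma measure_le_sum_cover (d : measure_display) (T : measurableType d)
    (R : realType) (mu : {measure set T -> \bar R}) (I : Type) (s : seq I)
    (F : I -> set T) (A : set T) :
  measurable A -> (forall i, measurable (F i)) ->
  A `<=` \big[setU/set0]_(i <- s) F i ->
  (mu A <= \sum_(i <- s) mu (F i))%E.
Proof.
move=> mA mF sA.
apply: (@le_trans _ _ (mu (\big[setU/set0]_(i <- s) F i))).
  by apply: le_measure; rewrite ?inE //; exact: bigsetU_measurable.
elim: s {sA} => [|i s ih]; first by rewrite !big_nil measure0.
rewrite !big_cons; apply: (le_trans (measureU2 _ _ _)) => //.
  exact: bigsetU_measurable.
exact: leeD2l.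
Qed.

Lemma sum_measure_disjoint_le (d : measure_display) (T : measurableType d)
    (R : realType) (mu : {measure set T -> \bar R}) (I : eqType) (s : seq I)
    (F : I -> set T) (A : set T) :
  measurable A -> (forall i, measurable (F i)) -> (forall i, F i `<=` A) ->
  (forall i j x, F i x -> F j x -> i = j) -> uniq s ->
  (\sum_(i <- s) mu (F i) <= mu A)%E.
Proof.
move=> mA mF FA tF us.
have {}FA i : i \in s -> F i `<=` A by move=> _; exact: FA.
elim: s A mA us FA => [|i s ih] A mA; first by rewrite big_nil measure_ge0.
move=> /= /andP[nis us] FA; rewrite big_cons.
have -> : mu A = (mu (F i) + mu (A `\` F i))%E.
  rewrite -measureU //; first by rewrite setDE setUIr setUv setIT setUidr //;
    apply: FA; rewrite mem_head.
    exact: measurableD.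
  by rewrite setDIK.
apply: leeD2l; apply: ih => //; first exact: measurableD.
move=> j js x Fjx; split; first by apply: (FA j) => //; rewrite in_cons js orbT.
by move=> Fix; move: nis; rewrite (tF _ _ _ Fix Fjx) js.
Qed.

(** An enumeration of the sup-norm ball of radius [r], which contains the word ball of radius [r]
    and has the explicit cardinality [(2r+1)^n]. *)
Definition box_elt (n r : nat) (f : {ffun 'I_n -> 'I_(r.*2.+1)}) : Zn n :=
  \row_i ((f i)%:Z - r%:Z).

Lemma box_elt_cover (n r : nat) (l : Zn n) : (wordlen l <= r)%N ->
  exists f : {ffun 'I_n -> 'I_(r.*2.+1)}, box_elt f = l.
Proof.
move=> lr.
have lb i : (`|(l ord0 i + r%:Z)%R|%N < r.*2.+1)%N.
  have := leq_trans (wordlen_coord l i) lr.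
  by move: (l ord0 i) => z; lia.
exists [ffun i => Ordinal (lb i)]; apply/rowP => i; rewrite mxE ffunE /=.
have := leq_trans (wordlen_coord l i) lr.
by move: (l ord0 i) => z; lia.
Qed.

Section Displacement.
Variables (R : realType) (d : measure_display) (T : measurableType d).
Variables (mu : {measure set T -> \bar R}) (m n : nat).
Variables (actG : Zn m -> T -> T) (actL : Zn n -> T -> T) (XG X : set T).
Hypothesis G_mp : mp_free_action mu actG.
Hypothesis L_mp : mp_free_action mu actL.
Hypothesis actC : forall g l x, actG g (actL l x) = actL l (actG g x).
Hypothesis XD : fund_domain actL X.
Hypothesis XGD : fund_domain actG XG.

Local Notation pi := (return_elt actL X).

Let mX : measurable X := XD.1.

(** On [X] this is the length of the cocycle. Subtracting [pi x] extends it to an [actL]-invariant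
    function on [T], to which [integral_invariant_act] applies after truncation. *)
Definition displ (g : Zn m) (x : T) : nat := wordlen (pi (actG g x) - pi x).

Lemma displ_measurable g : level_measurable (displ g).
Proof.
apply: (@measurable_preimage2 _ _ (Zn n) (Zn n) nat (fun x => pi (actG g x)) pi
  (fun u v => wordlen (u - v))); last exact: (return_elt_measurable L_mp XD).
move=> l; exact: (act_preimage_measurable G_mp g (return_elt_measurable L_mp XD l)).
Qed.

Lemma displD g h x : (displ (g + h) x <= displ g (actG h x) + displ h x)%N.
Proof.
rewrite /displ (act_add G_mp) (leq_trans _ (wordlenD _ _)) //.
by rewrite addrA subrK.
Qed.

Lemma displ0 x : displ 0 x = 0%N.
Proof. by rewrite /displ (act_id G_mp) subrr wordlen0. Qed.

Lemma displ_actL g l x : displ g (actL l x) = displ g x.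
Proof.
by rewrite /displ actC !(return_elt_act L_mp XD) opprB addrA subrK.
Qed.

Lemma displ_in g x : X x -> displ g x = wordlen (pi (actG g x)).
Proof. by move=> Xx; rewrite /displ (return_elt_in L_mp XD Xx) subr0. Qed.

Section Growth.
Variables (p : R) (M : nat) (eps : R).
Hypotheses (p0 : 0 < p) (p1 : p <= 1) (eps0 : 0 <= eps).
Hypothesis gen_excess : forall i : 'I_m,
  (\int[mu]_(x in X) npow p (excess M (displ (delta_mx ord0 i))) x <= eps%:E)%E.

(** For a sum [g] of [N] generators, the displacement splits into the truncated part, at most
    [N * M], and an invariant error [V] whose moment has the small slope [eps]. The bounded part is
    kept outside the [p]-th power until the end, where it costs only [(N M)^p]. *)
Definition displ_dominated (N : nat) (g : Zn m) : Prop :=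
  exists V : T -> nat, [/\ level_measurable V, forall l x, V (actL l x) = V x,
    forall x, (displ g x <= N * M + V x)%N &
    (\int[mu]_(x in X) npow p V x <= (N%:R * eps)%:E)%E].

Lemma displ_dominated0 : displ_dominated 0 0.
Proof.
exists (fun=> 0%N); split => //.
- move=> k; rewrite preimage_cst; case: ifP => _; [exact: measurableT|exact: measurable0].
- by move=> x; rewrite displ0.
- rewrite mul0r; under eq_integral do rewrite /npow powR0 ?gt_eqF //.
  by rewrite integral0.
Qed.

(** By the cocycle relation the error of the sum is [V1] moved by [g2], plus [V2]; moving an
    invariant function by [g2] leaves its integral over [X] unchanged. *)
Lemma displ_dominatedD N1 g1 N2 g2 :
  displ_dominated N1 g1 -> displ_dominated N2 g2 ->
  displ_dominated (N1 + N2)%N (g1 + g2).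
Proof.
move=> [V1 [mV1 iV1 dV1 bV1]] [V2 [mV2 iV2 dV2 bV2]].
have mV1' : level_measurable (fun x => V1 (actG g2 x)).
  by move=> k; exact: (act_preimage_measurable G_mp g2 (mV1 k)).
exists (fun x => V1 (actG g2 x) + V2 x)%N; split.
- exact: (@measurable_preimage2 _ _ nat nat nat _ V2 addn).
- by move=> l x; rewrite actC iV1 iV2.
- move=> x; apply: (leq_trans (displD _ _ _)).
  by rewrite mulnDl addnACA; apply: leq_add.
- apply: (le_trans (integral_npowD _ mX p0 p1 mV1' mV2)).
  rewrite natrD mulrDl EFinD; apply: leeD => //; apply: le_trans bV1.
  rewrite (integral_invariant_act G_mp L_mp actC XD g2 (npow_measurable p mV1)) //.
    by move=> x; exact: npow_ge0.
  by move=> l x; rewrite /npow iV1.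
Qed.

Lemma displ_dominated_gen i : displ_dominated 1 (delta_mx ord0 i).
Proof.
exists (excess M (displ (delta_mx ord0 i))); split.
- exact/excess_measurable/displ_measurable.
- by move=> l x; rewrite /excess displ_actL.
- by move=> x; rewrite /excess mul1n; case: ltnP => h; lia.
- by rewrite mul1r.
Qed.

Lemma displ_dominated_comb (k : 'I_m -> nat) :
  displ_dominated (\sum_i k i) (\sum_i delta_mx ord0 i *+ k i).
Proof.
apply: (big_ind2 displ_dominated) => //; first exact: displ_dominated0.
- by move=> *; exact: displ_dominatedD.
- move=> i _; elim: (k i) => [|j ih]; first by rewrite mulr0n; exact: displ_dominated0.
  by rewrite mulrS -addn1 addnC; apply: displ_dominatedD => //; exact: displ_dominated_gen.
Qed.

Lemma integral_displ_le (k : 'I_m -> nat) (N : nat) : (\sum_i k i <= N)%N ->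
  (\int[mu]_(x in X) npow p (displ (\sum_i delta_mx ord0 i *+ k i)) x <=
   (((N * M)%:R : R) `^ p)%:E * mu X + (N%:R * eps)%:E)%E.
Proof.
move=> kN; have [V [mV _ dV bV]] := displ_dominated_comb k.
have mc : level_measurable (fun x : T => (N * M)%N).
  by move=> j; rewrite preimage_cst; case: ifP => _; [exact: measurableT|exact: measurable0].
have mcV : level_measurable (fun x : T => (N * M) + V x)%N.
  exact: (@measurable_preimage2 _ _ nat nat nat _ V addn).
apply: (@le_trans _ _ (\int[mu]_(x in X) npow p (fun x => (N * M + V x)%N) x)%E).
  apply: integral_npow_le => //; first exact: displ_measurable.
  move=> x _; apply: (leq_trans (dV x)).
  by rewrite leq_add2r leq_mul2r kN orbT.
apply: (le_trans (integral_npowD _ mX p0 p1 mc mV)); apply: leeD.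
  by rewrite -integral_cst.
apply: (le_trans bV); rewrite lee_fin; apply: ler_wpM2r => //.
by rewrite ler_nat.
Qed.

End Growth.

(** * Counting the group elements with small displacement *)

Section Counting.
Variables (Y : set T) (g0 : Zn m).
Hypotheses (mY : measurable Y) (YX : Y `<=` X) (YG : Y `<=` actG g0 @^-1` XG).

(** Moving the [k]-th set by [gam k] and then by [l] puts it inside [X] without changing its
    measure. The images are disjoint: a common point [z] of two of them would give two
    [actG]-translates of [actL (- l) z] in [Y], hence in the same translate of the fundamental
    domain [XG]. *)
Lemma sum_measure_return_le (I : finType) (gam : I -> Zn m) (l : Zn n) :
  injective gam ->
  (\sum_(k : I) mu (Y `&` [set x | pi (actG (gam k) x) = l]) <= mu X)%E.
Proof.
move=> gam_inj.
pose B k := X `&` [set z | Y (actG (- gam k) (actL (- l) z))].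
have mYback k : measurable [set z | Y (actG (- gam k) (actL (- l) z))].
  exact: (act_preimage_measurable L_mp (- l)
    (act_preimage_measurable G_mp (- gam k) mY)).
have mB k : measurable (B k) by apply: measurableI.
have muB k : mu (Y `&` [set x | pi (actG (gam k) x) = l]) = mu (B k).
  rewrite -(act_preserves L_mp l (mB k)).
  rewrite -(act_preserves G_mp (gam k) (act_preimage_measurable L_mp l (mB k))).
  congr (mu _); apply/seteqP; split => x /=.
    move=> [Yx xl]; split; first by rewrite -xl; exact: (return_eltP XD).
    by rewrite /= (actK L_mp) (actK G_mp).
  move=> [Xx]; rewrite /= (actK L_mp) (actK G_mp) => Yx; split => //.
  exact: (return_elt_uniq XD).
under eq_bigr do rewrite muB.
apply: sum_measure_disjoint_le => //.
- by move=> k x [].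
- move=> i j z [_ /YG /= hi] [_ /YG /= hj]; apply: gam_inj.
  move: hi hj; rewrite -!(act_add G_mp) => hi hj.
  have [g [_ gu]] := XGD.2 (actL (- l) z).
  have := gu _ hi; rewrite (gu _ hj) => /addrI /oppr_inj.
  by [].
- exact: index_enum_uniq.
Qed.

(** For each [k], a point of [Y] is either displaced by more than [r] or returned by one of the
    [(2r+1)^n] box elements. Summing over [k] and exchanging the sums, each box element accounts for
    at most [mu X]. *)
Lemma card_le_displ (I : finType) (gam : I -> Zn m) (r : nat) : injective gam ->
  (#|I|%:R%:E * mu Y <= ((r.*2.+1) ^ n)%:R%:E * mu X +
     \sum_(k : I) mu (X `&` [set x | (r < displ (gam k) x)%N]))%E.
Proof.
move=> gam_inj.
have mret k l : measurable (Y `&` [set x | pi (actG (gam k) x) = l]).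
  apply: measurableI => //.
  exact: (act_preimage_measurable G_mp _ (return_elt_measurable L_mp XD l)).
have mfar k : measurable (X `&` [set x | (r < displ (gam k) x)%N]).
  apply: measurableI => //; rewrite -[X in measurable X]setTI.
  apply: (@measurable_preimage_pred _ _ _ (displ (gam k)) setT [set v | (r < v)%N]).
  by move=> i; rewrite setTI; exact: displ_measurable.
have split_k k : (mu Y <= \sum_(f : {ffun 'I_n -> 'I_(r.*2.+1)})
     mu (Y `&` [set x | pi (actG (gam k) x) = box_elt f]) +
     mu (X `&` [set x | (r < displ (gam k) x)%N]))%E.
  pose F (o : option {ffun 'I_n -> 'I_(r.*2.+1)}) := match o with
    | Some f => Y `&` [set x | pi (actG (gam k) x) = box_elt f]
    | None => X `&` [set x | (r < displ (gam k) x)%N] end.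
  have := @measure_le_sum_cover _ _ _ mu _
    (None :: [seq Some f | f <- index_enum {ffun 'I_n -> 'I_(r.*2.+1)}]) F Y mY.
  rewrite !big_cons !big_map addeC; apply; first by move=> [f|]; [exact: mret|exact: mfar].
  move=> x Yx; have [far|near] := ltnP r (displ (gam k) x).
    by left; split => //; exact: YX.
  rewrite (displ_in _ (YX Yx)) in near.
  have [f fl] := box_elt_cover near.
  right; rewrite (bigD1 f) //=; left; split => //=.
rewrite (_ : #|I|%:R%:E * mu Y = \sum_(k : I) mu Y)%E; last first.
  by rewrite sumr_const mule_natl.
apply: (@le_trans _ _ (\sum_(k : I) (\sum_(f : {ffun 'I_n -> 'I_(r.*2.+1)})
     mu (Y `&` [set x | pi (actG (gam k) x) = box_elt f]) +
     mu (X `&` [set x | (r < displ (gam k) x)%N])))%E).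
  by apply: lee_sum => k _; exact: split_k.
rewrite big_split /=; apply: leeD2r; rewrite exchange_big /=.
apply: (@le_trans _ _ (\sum_(f : {ffun 'I_n -> 'I_(r.*2.+1)}) mu X)%E).
  by apply: lee_sum => f _; exact: sum_measure_return_le.
by rewrite sumr_const card_ffun !card_ord mule_natl.
Qed.

End Counting.
End Displacement.

(** * Arithmetic of the scales *)

Lemma natr_powR_le (R : realType) (N : nat) (p q : R) :
  0 < q -> q <= p -> (N%:R : R) `^ q <= N%:R `^ p.
Proof.
move=> q0 qp; case: N => [|N]; last by apply: ler_powR => //; rewrite ler1n.
by rewrite !powR0 // gt_eqF // (lt_le_trans q0).
Qed.

(** Box sides and radii are taken to be suitable integer powers, so that the exponent [a / b]
    produces integers again. *)
Lemma exp_powR_div (R : realType) (x : nat) (a b c : nat) : (0 < b)%N ->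
  ((x ^ (b * c))%:R : R) `^ (a%:R / b%:R) = (x ^ (a * c))%:R.
Proof.
move=> b0; rewrite natrX -powR_mulrn // -powRrM natrX -powR_mulrn //; congr (_ `^ _).
by rewrite !natrM; field; rewrite pnatr_eq0 -lt0n.
Qed.

Lemma archi_nat (R : realType) (x y : R) : 0 < y ->
  exists2 k : nat, (0 < k)%N & x <= k%:R * y.
Proof.
move=> y0; exists (Num.trunc (x / y)).+1 => //.
by rewrite -ler_pdivrMr //; exact/ltW/truncnS_gt.
Qed.

(** Here [A] and [B] stand for the measures of [X] and [Y], and [F] for that of the points displaced
    by more than [m^(b^2)] by an element of a box of side [(k m)^(a b)]. The factor of [F] is at
    least [m^(a b)], so each term on the right should be at most [m^(a b) B / 4]. The choice of
    [eps] does this for the second term. The first contains only [m^(a^2)], and [a^2 + 1 <= a b]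
    leaves a factor [m] to absorb the constants. *)
Lemma scale_choice (R : realType) (a b k M m : nat) (A B eps F : R) :
  (0 < a)%N -> (a < b)%N -> (0 < k)%N -> (0 < m)%N -> 0 <= A -> 0 < B ->
  eps = B / (4 * b%:R * (k ^ (a * b))%:R) ->
  b%:R * M%:R * (k ^ (a * a))%:R * A <= m%:R * (B / 4) ->
  ((m ^ (b * b)).+1)%:R `^ (a%:R / b%:R) * F <=
    ((b * (k * m) ^ (a * b) * M)%:R `^ (a%:R / b%:R)) * A +
      (b * (k * m) ^ (a * b))%:R * eps ->
  F <= B / 2.
Proof.
move=> a0 ab k0 m0 A0 B0 epsE mE.
set q := a%:R / b%:R => FE.
have b0 : (0 < b)%N by lia.
have bR : 0 < b%:R :> R by rewrite ltr0n.
have q0 : 0 < q by rewrite divr_gt0 // ltr0n.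
have q1 : q <= 1 by rewrite ler_pdivrMr // mul1r ler_nat ltnW.
have kR j : 0 < (k ^ j)%:R :> R by rewrite ltr0n expn_gt0 k0.
have mR j : 0 < (m ^ j)%:R :> R by rewrite ltr0n expn_gt0 m0.
have [F0|F0] := leP F 0; first by rewrite (le_trans F0) // divr_ge0 // ltW.
have h1 : (m ^ (a * b))%:R * F <=
    ((b * (k * m) ^ (a * b) * M)%:R `^ q) * A + (b * (k * m) ^ (a * b))%:R * eps.
  apply: le_trans FE; rewrite ler_pM2r // -(exp_powR_div R m a b b0).
  by apply: ge0_ler_powR; rewrite ?nnegrE ?ler_nat // ltW.
have h2 : (b * (k * m) ^ (a * b) * M)%:R `^ q <=
    b%:R * M%:R * (k ^ (a * a))%:R * (m ^ (a * a))%:R :> R.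
  have -> : (b * (k * m) ^ (a * b) * M = (b * M) * (k * m) ^ (b * a))%N.
    by rewrite [(a * b)%N]mulnC; lia.
  rewrite natrM powRM // exp_powR_div // expnMn !natrM !mulrA.
  do 2 (apply: ler_wpM2r => //).
  (* The constant [b * M] is an integer, so its power of exponent [q <= 1] is at most itself. *)
  rewrite -natrM; apply: (le_trans (natr_powR_le _ q0 q1)).
  by rewrite powRr1.
have h3 : (m ^ (a * b))%:R * F <= (m ^ (a * b))%:R * (B / 2).
  apply: (le_trans h1).
  have e1 : (b * (k * m) ^ (a * b))%:R * eps = (m ^ (a * b))%:R * (B / 4).
    rewrite epsE expnMn !natrM; field.
    by rewrite !gt_eqF.
  have e2 : ((b * (k * m) ^ (a * b) * M)%:R `^ q) * A <= (m ^ (a * b))%:R * (B / 4).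
    apply: (le_trans (ler_wpM2r A0 h2)).
    apply: (@le_trans _ _ ((m ^ (a * a))%:R * (m%:R * (B / 4)))).
      have := ler_wpM2l (ltW (mR (a * a)%N)) mE; lra.
    rewrite mulrA ler_pM2r ?divr_gt0 // -natrM -expnSr ler_nat leq_pexp2l //; nia.
  by rewrite e1; lra.
by rewrite ler_pM2l in h3.
Qed.

(** With [r = m^(b^2)], the left side is at most [3^a r^a A], while the box has at least [k r^a]
    elements; the choice of [k] beats the constant. *)
Lemma box_count_le (R : realType) (a b k m : nat) (A B : R) :
  (0 < a)%N -> (0 < b)%N -> (0 < k)%N -> (0 < m)%N -> 0 <= A -> 0 < B ->
  3 * 3 ^+ a * A <= k%:R * B ->
  (((m ^ (b * b)).*2.+1) ^ a)%:R * A <= (((k * m) ^ (a * b)) ^ b)%:R * (B / 3).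
Proof.
move=> a0 b0 k0 m0 A0 B0 kE.
have h1 : (((m ^ (b * b)).*2.+1) ^ a <= 3 ^ a * (m ^ (b * b)) ^ a)%N.
  have : (0 < m ^ (b * b))%N by rewrite expn_gt0 m0.
  by move: (m ^ (b * b))%N => r r0; rewrite -expnMn leq_exp2r //; lia.
have h2 : (k * (m ^ (b * b)) ^ a <= ((k * m) ^ (a * b)) ^ b)%N.
  rewrite -!expnM [(a * b * b)%N](_ : _ = b * b * a)%N; last by rewrite -mulnA mulnC.
  rewrite expnMn leq_mul2r; apply/orP; right; rewrite -[leqLHS]expn1 leq_pexp2l //.
  by rewrite !muln_gt0 b0 a0.
have {}h1 : (((m ^ (b * b)).*2.+1) ^ a)%:R <= 3 ^+ a * ((m ^ (b * b)) ^ a)%:R :> R.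
  by rewrite -natrX -natrM ler_nat.
have {}h2 : k%:R * ((m ^ (b * b)) ^ a)%:R <= (((k * m) ^ (a * b)) ^ b)%:R :> R.
  by rewrite -natrM ler_nat.
have r0 : 0 <= ((m ^ (b * b)) ^ a)%:R :> R by [].
apply: (le_trans (ler_wpM2r A0 h1)); move: h2 kE r0 {h1}.
move: (((m ^ (b * b)) ^ a)%N%:R : R) ((((k * m) ^ (a * b)) ^ b)%N%:R : R) (3 ^+ a : R)
  => r n t h2 kE r0.
have := ler_wpM2r (divr_ge0 (ltW B0) (ler0n R 3)) h2.
have := ler_wpM2l r0 kE; lra.
Qed.

(** * Non-existence at and above the critical exponent *)

Theorem no_critical_coupling (R : realType) (a b : nat) (p : R) :
  (0 < a)%N -> (a < b)%N -> a%:R / b%:R <= p -> ~ exists_LpL0_coupling p b a.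
Proof.
move=> a0 ab qp [d [T [mu [actG [actL [XG [X]]]]]]].
move=> [[_ muT] [G_mp L_mp] actC [XGD _ XD muX] Lp].
have b0 : (0 < b)%N by lia.
set q : R := a%:R / b%:R in qp.
have bR : 0 < b%:R :> R by rewrite ltr0n.
have q0 : 0 < q by rewrite divr_gt0 // ltr0n.
have q1 : q <= 1 by rewrite ler_pdivrMr // mul1r ler_nat ltnW.
have mX := XD.1.
(* Displacements are integers, so their [q]-th power is at most their [p]-th power: it suffices to
   refute the critical exponent [q]. *)
have Lq g : (\int[mu]_(x in X) npow q (displ actG actL X g) x < +oo)%E.
  have /integrableP[mc] := Lp g; apply: le_lt_trans.
  apply: ge0_le_integral => //.
  - by move=> x _; exact: npow_ge0.
  - exact/measurable_funTS/npow_measurable/(displ_measurable G_mp L_mp XD).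
  - exact: measurableT_comp.
  - move=> x Xx; rewrite gee0_abs ?lee_fin ?powR_ge0 //.
    by rewrite (displ_in actG L_mp XD) //; exact: natr_powR_le.
(* The translates of [XG] cover [X], which has positive measure, so one of them meets [X] in a set
   [Y] of positive measure. *)
have [|g0] := @measure_gt0_level _ _ _ mu _ (return_elt actG XG) X mX _
    (fund_domain_gt0 L_mp XD muT).
  by move=> g; apply: measurableI => //; exact: (return_elt_measurable G_mp XGD).
rewrite (return_elt_preimage XGD); set Y := X `&` _ => muY.
have mY : measurable Y.
  by apply: measurableI => //; apply: (act_preimage_measurable G_mp); exact: XGD.1.
have YX : Y `<=` X by move=> x [].
have YG : Y `<=` actG g0 @^-1` XG by move=> x [].
have Xfin : mu X \is a fin_num by rewrite ge0_fin_numE.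
have Yfin : mu Y \is a fin_num.
  by rewrite ge0_fin_numE // (le_lt_trans _ muX) // le_measure // inE.
pose A := fine (mu X); pose B := fine (mu Y).
have B0 : 0 < B by rewrite fine_gt0 // muY ltey_eq Yfin.
have A0 : 0 <= A by exact: fine_ge0.
(* The order of the choices matters: [k] depends only on the measures of [X] and [Y], [eps] on [k],
   the truncation level [M] on [eps], and [m] comes last. *)
have [k k0 kE] := archi_nat (3 * 3 ^+ a * A) B0.
pose eps := B / (4 * b%:R * (k ^ (a * b))%:R).
have eps0 : 0 < eps by rewrite !divr_gt0 // !mulr_gt0 // ltr0n expn_gt0 k0.
have [M HM] : exists M, forall i : 'I_b, (\int[mu]_(x in X)
    npow q (excess M (displ actG actL X (delta_mx ord0 i))) x <= eps%:E)%E.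
  have ex i : exists M, (\int[mu]_(x in X)
      npow q (excess M (displ actG actL X (delta_mx ord0 i))) x <= eps%:E)%E.
    by apply: excess_small => //; exact: (displ_measurable G_mp L_mp XD).
  have [f Hf] := choice ex.
  (* The excess decreases when the threshold grows, so the largest of the thresholds serves all
     generators. *)
  exists (\max_i f i)%N => i; apply: le_trans (Hf i).
  apply: integral_npow_le => //.
  - exact/excess_measurable/(displ_measurable G_mp L_mp XD).
  - exact/excess_measurable/(displ_measurable G_mp L_mp XD).
  - move=> x _; rewrite /excess leq_mul2r; apply/orP; right.
    case: ltnP => // h; rewrite lt0b.
    exact: leq_ltn_trans (leq_bigmax _) h.
have [m m0 mE] := archi_nat (b%:R * M%:R * (k ^ (a * a))%:R * A)
  (divr_gt0 B0 (ltr0n R 4)).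
(* Since [n^(b/a) = (k m)^(b^2)], the radius [r] is [n^(b/a)] times the small constant
   [k^(-b^2)]. *)
pose n := ((k * m) ^ (a * b))%N; pose r := (m ^ (b * b))%N.
pose gam (f : {ffun 'I_b -> 'I_n}) : Zn b := \sum_i delta_mx ord0 i *+ f i.
have gamE f j : gam f ord0 j = f j.
  rewrite /gam summxE (bigD1 j) //= big1 ?addr0.
    by rewrite mulmxnE mxE !eqxx /=; exact: natz.
  by move=> i ij; rewrite mulmxnE mxE eq_sym (negbTE ij) andbF mul0rn.
have gam_inj : injective gam.
  move=> f f' ff; apply/ffunP => j; apply/val_inj.
  by have := gamE f j; rewrite ff gamE => -[].
have far f : (mu (X `&` [set x | (r < displ actG actL X (gam f) x)%N]) <=
    (B / 2)%:E)%E.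
  have mk := npow_markov mu mX q0 r (displ_measurable G_mp L_mp XD (gam f)).
  have fN : (\sum_i f i <= b * n)%N.
    rewrite -[b in (b * n)%N]card_ord -sum_nat_const; apply: leq_sum => i _.
    exact/ltnW.
  have := le_trans mk (integral_displ_le G_mp L_mp actC XD q0 q1 (ltW eps0) HM fN).
  set far := X `&` _.
  have mfar : measurable far.
    apply: measurableI => //; rewrite -[X in measurable X]setTI.
    apply: (@measurable_preimage_pred _ _ _ (displ actG actL X (gam f)) setT
      [set v | (r < v)%N]).
    by move=> i; rewrite setTI; exact: (displ_measurable G_mp L_mp XD).
  have farfin : mu far \is a fin_num.
    rewrite ge0_fin_numE // (le_lt_trans _ muX) // le_measure ?inE //.
    by move=> x [].
  rewrite -(fineK farfin) -(fineK Xfin) -!EFinM -EFinD !lee_fin => h.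
  exact: (scale_choice a0 ab k0 m0 A0 B0 erefl mE h).
have := card_le_displ G_mp L_mp XD XGD mY YX YG r gam_inj.
apply/negP; rewrite -ltNge.
have nb0 : 0 < (n ^ b)%:R :> R by rewrite ltr0n !expn_gt0 muln_gt0 k0 m0.
apply: (@le_lt_trans _ _ (((r.*2.+1) ^ a)%:R%:E * mu X + (n ^ b)%:R%:E * (B / 2)%:E)%E).
  apply: leeD2l; apply: (@le_trans _ _ (\sum_(f : {ffun 'I_b -> 'I_n}) (B / 2)%:E)%E).
    exact: lee_sum.
  by rewrite sumr_const card_ffun !card_ord mule_natl.
rewrite card_ffun !card_ord -(fineK Xfin) -(fineK Yfin) -!EFinM -EFinD lte_fin -/A -/B.
(* Far points use up half of [n^b * B]; returns bounded by a third of it leave a strict inequality,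
   as [1/2 + 1/3 < 1]. *)
suff : ((r.*2.+1) ^ a)%:R * A <= (n ^ b)%:R * (B / 3).
  move=> h; rewrite (le_lt_trans (lerD h (lexx _))) //.
  by have := mulr_gt0 nb0 B0; lra.
exact: box_count_le.
Qed.

(** * Odometers on binary sequences *)

Definition tail_eq (K : nat) (x y : nat -> bool) : Prop :=
  forall k, (K <= k)%N -> x k = y k.

Lemma tail_eq_le K K' x y : (K <= K')%N -> tail_eq K x y -> tail_eq K' x y.
Proof. by move=> KK h k /(leq_trans KK) /h. Qed.

Definition binval (u : nat -> bool) (m : nat) : nat := (\sum_(j < m) u j * 2 ^ j)%N.

Lemma binvalS u m : binval u m.+1 = (u 0 + 2 * binval (fun j => u j.+1) m)%N.
Proof.
rewrite /binval big_ord_recl expn0 muln1 big_distrr /=; congr (_ + _)%N.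
by apply: eq_bigr => j _; rewrite /bump /= add1n expnS mulnCA.
Qed.

Lemma binvalSr u m : binval u m.+1 = (binval u m + u m * 2 ^ m)%N.
Proof. by rewrite /binval big_ord_recr. Qed.

Lemma binval_lt u m : (binval u m < 2 ^ m)%N.
Proof.
elim: m => [|m ih]; first by rewrite /binval big_ord0.
by rewrite binvalSr expnS; case: (u m); lia.
Qed.

Lemma binval_ge (u : nat -> bool) m j : (j < m)%N -> u j -> (2 ^ j <= binval u m)%N.
Proof.
elim: m => // m ih; rewrite ltnS leq_eqVlt binvalSr => /orP[/eqP -> ->|jm uj].
  by rewrite mul1n leq_addl.
by rewrite (leq_trans (ih jm uj)) // leq_addr.
Qed.

Lemma binval_lt_false (u : nat -> bool) m j : (j < m)%N -> u j = false ->
  (binval u m + 2 ^ j < 2 ^ m)%N.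
Proof.
elim: m => // m ih; rewrite ltnS leq_eqVlt binvalSr expnS => /orP[/eqP -> ->|jm uj].
  by have := binval_lt u m; lia.
by have := ih jm uj; case: (u m); lia.
Qed.

Lemma binval_inj (u v : nat -> bool) m : binval u m = binval v m ->
  forall j, (j < m)%N -> u j = v j.
Proof.
elim: m u v => // m ih u v; rewrite !binvalS => h.
have uv0 : u 0%N = v 0%N by move: h; case: (u _); case: (v _); lia.
have := ih (fun j => u j.+1) (fun j => v j.+1) _.
rewrite uv0 in h; have {}h : binval (fun j => u j.+1) m = binval (fun j => v j.+1) m by lia.
by move=> /(_ h) H [|j] //; rewrite ltnS; exact: H.
Qed.

Lemma binval_digits N m : (N < 2 ^ m)%N -> binval (fun j => odd (N %/ 2 ^ j)) m = N.
Proof.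
elim: m N => [|m ih] N; first by rewrite /binval big_ord0; case: N.
rewrite expnS binvalS => Nm.
have := ih (N %/ 2)%N; rewrite expn0 divn1 => h.
rewrite (_ : (fun j => _) = (fun j => odd ((N %/ 2) %/ 2 ^ j))).
  by rewrite h //; lia.
by apply: funext => j; rewrite -divnMA -expnS.
Qed.

Section Odometer.
Variable n : nat.

(* Deinterleaving: the [i]-th dyadic coordinate of [x] consists of the digits
   of [x] at the positions congruent to [i] modulo [n]. *)
Definition coordval (m i : nat) (x : nat -> bool) : nat :=
  binval (fun j => x (j * n + i)%N) m.

(** Addition of [g] in which no carry leaves the first [m] digits of any coordinate. A relation is
    used because at exceptional sequences a carry never stops. *)
Definition odometer_at (m : nat) (g : Zn n) (x y : nat -> bool) : Prop :=
  tail_eq (m * n) x y /\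
  forall i : 'I_n, (coordval m i y)%:Z = (coordval m i x)%:Z + g ord0 i.

Definition odometer (g : Zn n) (x y : nat -> bool) : Prop :=
  exists m, odometer_at m g x y.

Lemma odometer_at_le m m' g x y : (m <= m')%N ->
  odometer_at m g x y -> odometer_at m' g x y.
Proof.
move=> mm [txy cxy]; split.
  by apply: tail_eq_le txy; rewrite leq_mul2r mm orbT.
move=> i; rewrite -(subnK mm); elim: (m' - m)%N => [|e ih]; first exact: cxy.
rewrite addSn /coordval !binvalSr -!/(coordval _ _ _) !PoszD ih.
rewrite (txy ((e + m) * n + i)%N); last by nia.
by lia.
Qed.

Lemma odometer_refl x : odometer 0 x x.
Proof. by exists 0%N; split => // i; rewrite mxE addr0. Qed.

Lemma odometer_trans g h x y z :
  odometer g x y -> odometer h y z -> odometer (g + h) x z.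
Proof.
move=> [m1 h1] [m2 h2].
have [t1 c1] := odometer_at_le (leq_maxl m1 m2) h1.
have [t2 c2] := odometer_at_le (leq_maxr m1 m2) h2.
exists (maxn m1 m2); split; first by move=> k hk; rewrite t1 // t2.
by move=> i; rewrite c2 c1 mxE addrA.
Qed.

Lemma odometer_elt_uniq g h x y : odometer g x y -> odometer h x y -> g = h.
Proof.
move=> [m1 h1] [m2 h2].
have [_ c1] := odometer_at_le (leq_maxl m1 m2) h1.
have [_ c2] := odometer_at_le (leq_maxr m1 m2) h2.
by apply/rowP => i; have := c2 i; rewrite c1 => /addrI.
Qed.

(** Each of the [n] coordinates has only its first [m] digits free, so it moves by less than [2^m].
    This is the source of the bound on the cocycle. *)
Lemma tail_eq_odometer m x y : tail_eq (m * n) x y ->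
  exists2 g, odometer_at m g x y & (wordlen g <= n * 2 ^ m)%N.
Proof.
move=> txy.
exists (\row_i ((coordval m i y)%:Z - (coordval m i x)%:Z)).
  by split=> // i; rewrite mxE addrC subrK.
rewrite /wordlen -[n in leqRHS]card_ord -sum_nat_const; apply: leq_sum => i _.
rewrite mxE; have := binval_lt (fun j => x (j * n + i)%N) m.
have := binval_lt (fun j => y (j * n + i)%N) m.
by rewrite -!/(coordval _ _ _); lia.
Qed.

Lemma odometer_tail_eq g x y : odometer g x y -> exists K, tail_eq K x y.
Proof. by move=> [m [t _]]; exists (m * n)%N. Qed.

Hypothesis n_gt0 : (0 < n)%N.

Lemma tail_eq_odometer_ex K x y : tail_eq K x y -> exists g, odometer g x y.
Proof.
move=> t; have [|g h _] := @tail_eq_odometer K x y; last by exists g, K.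
by apply: tail_eq_le t; rewrite leq_pmulr.
Qed.

Lemma odometer_inj g x y z : odometer g x y -> odometer g x z -> y = z.
Proof.
move=> [m1 h1] [m2 h2].
have [t1 c1] := odometer_at_le (leq_maxl m1 m2) h1.
have [t2 c2] := odometer_at_le (leq_maxr m1 m2) h2.
apply: funext => k; have [hk|hk] := leqP (maxn m1 m2 * n) k; first by rewrite -t1 // t2.
have := c2 (Ordinal (ltn_pmod k n_gt0)); rewrite -c1 => -[] /binval_inj /(_ (k %/ n)%N).
by rewrite ltn_divLR // => /(_ hk); rewrite /= -divn_eq.
Qed.

(** Digits from [K] on agree in [x] and [y], and in [x0] and [y0], so they cancel in the differences
    of coordinates; the group element is determined by the first [K] digits. *)
Lemma odometer_local K g x y x0 y0 :
  tail_eq K x0 y0 -> (forall k, (k < K)%N -> x k = x0 k) ->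
  (forall k, (k < K)%N -> y k = y0 k) -> tail_eq K x y ->
  odometer g x0 y0 -> odometer g x y.
Proof.
move=> t0 xx0 yy0 t [m h].
have [_ c] := odometer_at_le (leq_maxl m K) h.
exists (maxn m K); split.
  by apply: tail_eq_le t; rewrite (leq_trans (leq_maxr m K)) // leq_pmulr.
move=> i; have := c i.
suff : (coordval (maxn m K) i y + coordval (maxn m K) i x0 =
        coordval (maxn m K) i y0 + coordval (maxn m K) i x)%N by lia.
rewrite /coordval /binval -!big_split /=; apply: eq_bigr => j _.
rewrite -!mulnDl; congr (_ * _)%N.
have [kK|Kk] := ltnP (j * n + i)%N K; first by rewrite xx0 // yy0 // addnC.
by rewrite (t _ Kk) (t0 _ Kk) addnC.
Qed.

(* A carry of [g] in coordinate [i] is absorbed by a digit 1 (resp. 0) above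
   level [s] when [g i] is negative (resp. positive). *)
Lemma odometer_at_ex (s m : nat) (g : Zn n) (x : nat -> bool) :
  (forall i, (`|g ord0 i| <= 2 ^ s)%N) ->
  (forall (i : 'I_n) v, exists j, [/\ (s <= j)%N, (j < m)%N & x (j * n + i)%N = v]) ->
  exists y, odometer_at m g x y.
Proof.
move=> gs xs.
have range (i : 'I_n) : (0 <= (coordval m i x)%:Z + g ord0 i) &&
    ((coordval m i x)%:Z + g ord0 i < (2 ^ m)%N%:Z).
  have [j1 [sj1 jm1 x1]] := xs i true; have [j0 [sj0 jm0 x0]] := xs i false.
  have := binval_ge jm1 (_ : (fun j => x (j * n + i)%N) j1); rewrite x1 => /(_ isT).
  have := @binval_lt_false (fun j => x (j * n + i)%N) m j0 jm0 x0.
  have := leq_trans (gs i) (leq_pexp2l (isT : 0 < 2)%N sj1).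
  have := leq_trans (gs i) (leq_pexp2l (isT : 0 < 2)%N sj0).
  rewrite -!/(coordval _ _ _).
  move: (g ord0 i) (coordval m i x) => z c.
  move: (2 ^ j0)%N (2 ^ j1)%N (2 ^ m)%N => A B C; lia.
pose N (i : 'I_n) := `|((coordval m i x)%:Z + g ord0 i)%R|%N.
pose y k := if (k < m * n)%N
  then odd (N (Ordinal (ltn_pmod k n_gt0)) %/ 2 ^ (k %/ n)) else x k.
exists y; split; first by move=> k hk; rewrite /y ltnNge hk.
move=> i; have /andP[N0 N1] := range i.
have NE : (N i)%:Z = (coordval m i x)%:Z + g ord0 i.
  by rewrite /N; move: (coordval m i x) (g ord0 i) N0 => c z; lia.
rewrite -NE; congr Posz.
rewrite -[RHS](@binval_digits (N i) m); last by rewrite -ltz_nat NE.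
rewrite /coordval /binval; apply: eq_bigr => j _.
have jn : (j * n + i < m * n)%N by have := ltn_ord j; have := ltn_ord i; nia.
rewrite /y jn (_ : (j * n + i) %/ n = j)%N; last first.
  by rewrite divnMDl // (divn_small (ltn_ord i)) addn0.
congr ((odd (N _ %/ _) : nat) * _)%N.
by apply: val_inj; rewrite /= modnMDl modn_small.
Qed.

End Odometer.

(** Allowing every modulus makes one set of points serve both odometers. Allowing every offset [r]
    yields occurrences arbitrarily far out, whence the invariance under equality of tails. *)
Definition good (x : nat -> bool) : Prop :=
  forall M r v, (0 < M)%N -> exists j, x (r + j * M)%N = v.

Lemma good_tail_eq K x y : tail_eq K x y -> good x -> good y.
Proof.
move=> t gx M r v M0; have [j xj] := gx M (r + K * M)%N v M0.
exists (K + j)%N; rewrite mulnDl addnA -t //; nia.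
Qed.

Lemma exp2_ge_all n (g : Zn n) : exists s, forall i, (`|g ord0 i| <= 2 ^ s)%N.
Proof.
exists (wordlen g) => i; apply: leq_trans (ltnW (ltn_expl _ (isT : 1 < 2)%N)).
exact: wordlen_coord.
Qed.

(** Above level [s] every coordinate of a good sequence contains both digits; a level [m] beyond
    finitely many such occurrences stops all carries. *)
Lemma odometer_ex n (g : Zn n) x : (0 < n)%N -> good x -> exists y, odometer g x y.
Proof.
move=> n0 gx; have [s gs] := exp2_ge_all g.
have ex (iv : 'I_n * bool) : exists j, x (s * n + iv.1 + j * n)%N = iv.2.
  exact: gx.
have [f Hf] := choice ex.
pose m := (s + (\max_iv f iv).+1)%N.
have [i v|y h] := @odometer_at_ex n n0 s m g x gs; last by exists y, m.
exists (s + f (i, v))%N; split; first by rewrite leq_addr.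
  by rewrite ltn_add2l ltnS; exact: leq_bigmax.
by rewrite -[RHS](Hf (i, v)) /=; congr x; lia.
Qed.

(** * Binary expansions *)

Section DyadicDigits.
Variable R : realType.
Implicit Types x y : R.

Definition unit_itv : set R := [set x | 0 <= x < 1].

Definition dyadic (K : nat) (x : R) : nat := Num.trunc (2 ^+ K * x).

Definition bits (x : R) (k : nat) : bool := odd (dyadic k.+1 x).

(** The most significant digit comes first, contrary to [binval]: early digits weigh most on the
    line and least in the odometer. *)
Fixpoint prefix_val (z : nat -> bool) (K : nat) : nat :=
  if K is K'.+1 then (2 * prefix_val z K' + z K')%N else 0%N.

Lemma eq_prefix_val (z z' : nat -> bool) K :
  (forall k, (k < K)%N -> z k = z' k) -> prefix_val z K = prefix_val z' K.
Proof.
elim: K => //= K ih h; rewrite h // ih // => k kK; apply: h; exact: ltnW.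
Qed.

Lemma prefix_val_lt z K : (prefix_val z K < 2 ^ K)%N.
Proof. by elim: K => //= K ih; rewrite expnS; case: (z K); lia. Qed.

Lemma dyadic_itv K x : 0 <= x ->
  (dyadic K x)%:R <= 2 ^+ K * x < (dyadic K x).+1%:R.
Proof. by move=> x0; apply: truncn_itv; rewrite mulr_ge0 // exprn_ge0. Qed.

Lemma dyadic_uniq K x i : i%:R <= 2 ^+ K * x < i.+1%:R -> dyadic K x = i.
Proof. exact: truncn_def. Qed.

Lemma dyadic0 x : unit_itv x -> dyadic 0 x = 0%N.
Proof. by move=> /andP[x0 x1]; apply: dyadic_uniq; rewrite expr0 mul1r x0. Qed.

Lemma dyadic_half K x : 0 <= x -> (dyadic K.+1 x)./2 = dyadic K x.
Proof.
move=> x0; symmetry; apply: dyadic_uniq; have := dyadic_itv K.+1 x0.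
move: (dyadic K.+1 x) => i; rewrite exprS -mulrA; set y := 2 ^+ K * x.
have := odd_double_half i; move: i./2 (odd i) => h o <-.
rewrite -[(_ + _).+1]addn1 -[h.+1]addn1 -mul2n !natrD.
by case: o => /=; lra.
Qed.

Lemma dyadicS K x : 0 <= x -> dyadic K.+1 x = (2 * dyadic K x + bits x K)%N.
Proof.
by move=> x0; rewrite -(dyadic_half K x0) mul2n addnC /bits odd_double_half.
Qed.

Lemma dyadic_prefix K x : unit_itv x -> dyadic K x = prefix_val (bits x) K.
Proof.
move=> ux; have /andP[x0 _] := ux.
by elim: K => [|K ih]; rewrite ?dyadic0 // dyadicS // ih.
Qed.

Lemma dyadic_eq_bits K x y : 0 <= x -> 0 <= y -> dyadic K x = dyadic K y ->
  forall k, (k < K)%N -> bits x k = bits y k.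
Proof.
move=> x0 y0; elim: K => // K ih xy k.
rewrite ltnS leq_eqVlt => /orP[/eqP ->|kK]; first by rewrite /bits xy.
by apply: ih => //; rewrite -(dyadic_half _ x0) -(dyadic_half _ y0) xy.
Qed.

(** The next [j] digits being equal for every [j], the two fractional parts differ by less than
    [2^(-j)] for every [j]. *)
Lemma tail_eq_frac K x y : 0 <= x -> 0 <= y -> tail_eq K (bits x) (bits y) ->
  2 ^+ K * x - (dyadic K x)%:R = 2 ^+ K * y - (dyadic K y)%:R.
Proof.
move=> x0 y0 t.
have step j : (dyadic (K + j) x)%:R - 2 ^+ j * (dyadic K x)%:R =
    (dyadic (K + j) y)%:R - 2 ^+ j * (dyadic K y)%:R :> R.
  elim: j => [|j ih]; first by rewrite addn0 expr0 !mul1r !subrr.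
  rewrite addnS !dyadicS // t ?leq_addr // !natrD exprS.
  by lra.
set u := LHS; set v := RHS.
have close j : 2 ^+ j * `|u - v| < 1.
  rewrite -[2 ^+ j]ger0_norm ?exprn_ge0 // -normrM ltr_norml.
  have := dyadic_itv (K + j) x0; have := dyadic_itv (K + j) y0; have := step j.
  rewrite exprD -[(dyadic _ x).+1%:R]natr1 -[(dyadic _ y).+1%:R]natr1 /u /v.
  move: (2 ^+ j : R) (2 ^+ K : R) => P Q.
  by lra.
apply/eqP; rewrite -subr_eq0 -normr_le0 leNgt; apply/negP => d0.
have := close (Num.trunc (`|u - v|^-1)).+1; apply/negP; rewrite -leNgt.
rewrite -ler_pdivrMr // mul1r; apply: (le_trans (ltW (truncnS_gt _))).
by rewrite -natrX ler_nat; exact/ltnW/ltn_expl.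
Qed.

Lemma tail_eq_diff K x y : unit_itv x -> unit_itv y -> tail_eq K (bits x) (bits y) ->
  y - x = ((prefix_val (bits y) K)%:R - (prefix_val (bits x) K)%:R) / 2 ^+ K.
Proof.
move=> ux uy t; have /andP[x0 _] := ux; have /andP[y0 _] := uy.
have := tail_eq_frac x0 y0 t; rewrite !dyadic_prefix // => h.
apply: (@mulIf _ (2 ^+ K)); first by rewrite expf_neq0 // pnatr_eq0.
rewrite divfK ?expf_neq0 ?pnatr_eq0 //; lra.
Qed.

Lemma bits_inj x y : unit_itv x -> unit_itv y -> bits x = bits y -> x = y.
Proof.
move=> ux uy xy; have := @tail_eq_diff 0 x y ux uy.
by rewrite xy /= subrr mul0r => /(_ (fun _ _ => erefl)) /subr0_eq.
Qed.

(** Sequences ending in ones are not of the form [bits y]; sharing a tail with [bits x] excludes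
    them. The point [y] keeps the fractional part of [2^K x] and takes the prefix of [z] as its
    integer part. *)
Lemma bits_surj_tail K x (z : nat -> bool) : unit_itv x -> tail_eq K (bits x) z ->
  exists2 y, unit_itv y & bits y = z.
Proof.
move=> ux t; have /andP[x0 x1] := ux.
pose c := prefix_val z K.
have [fr [frE fr0 fr1]] : exists fr,
    [/\ 2 ^+ K * x = (dyadic K x)%:R + fr, 0 <= fr & fr < 1].
  exists (2 ^+ K * x - (dyadic K x)%:R); have := dyadic_itv K x0.
  by rewrite -natr1 => h; split; lra.
have P0 j : 0 < 2 ^+ j :> R by rewrite exprn_gt0.
exists ((c%:R + fr) / 2 ^+ K).
  rewrite /unit_itv /= divr_ge0 ?addr_ge0 ?(ltW (P0 _)) //=.
  rewrite ltr_pdivrMr // mul1r.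
  have : (c.+1)%:R <= 2 ^+ K :> R by rewrite -natrX ler_nat; exact: prefix_val_lt.
  rewrite -natr1; lra.
set y := _ / _.
have yK : 2 ^+ K * y = c%:R + fr by rewrite mulrC divfK // gt_eqF.
have y0 : 0 <= y by rewrite divr_ge0 ?addr_ge0 ?(ltW (P0 _)).
have cy : dyadic K y = c by apply: dyadic_uniq; rewrite yK -natr1; lra.
have pre k : (k <= K)%N -> dyadic k y = prefix_val z k.
  move=> kK; rewrite -(subKn kK); elim: (K - k)%N (leq_subr k K) => [|j ih] jK.
    by rewrite subn0.
  have := ih (ltnW jK); rewrite -(subnSK jK) /= => h.
  by rewrite -(dyadic_half _ y0) h; case: (z _); lia.
(* For [j > 0] the term [2 ^ j * i] is even, so the digits from [K] on depend only on [fr], which is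
   common to [x] and [y]. *)
have farE w i j : 2 ^+ K * w = i%:R + fr ->
    dyadic (K + j) w = (2 ^ j * i + Num.trunc (2 ^+ j * fr))%N.
  move=> wK; apply: dyadic_uniq; rewrite exprD mulrAC wK.
  have := truncn_itv (mulr_ge0 (ltW (P0 j)) fr0); set e := Num.trunc _.
  rewrite -[e.+1%:R]natr1 -[(_ + _).+1%:R]natr1 natrD natrM natrX.
  by move: (2 ^+ j : R) => P; lra.
apply: funext => k; have [Kk|kK] := leqP K k.
  rewrite -t // /bits -(subnKC Kk) -addnS (farE _ _ _ yK) (farE _ _ _ frE).
  by rewrite !oddD !oddM !oddX.
by rewrite /bits pre //= oddD oddM /= oddb.
Qed.

End DyadicDigits.

(** * Lebesgue measure and binary digits *)

Lemma measurable_addr (R : realType) (t : R) :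
  measurable_fun setT ((fun x => x + t) : R -> R).
Proof. by apply: measurable_funD => //; exact: measurable_cst. Qed.

Lemma lebesgue_measure_shift (R : realType) (t : R) (A : set R) : measurable A ->
  lebesgue_measure ((fun x => x + t) @^-1` A) = lebesgue_measure A.
Proof.
move=> mA; symmetry.
pose nu : {measure set (measurableTypeR R) -> \bar R} :=
  pushforward (lebesgue_measure : {measure set (measurableTypeR R) -> \bar R})
    ((fun x => x + t) : measurableTypeR R -> measurableTypeR R).
apply: (@lebesgue_measure_unique R (nu (measurable_addr t))) => // X [[a b] _ <-] /=.
rewrite /nu /= /pushforward /=.
have -> : (fun x => x + t) @^-1` `]a, b] = `]a - t, b - t]%classic.
  by apply/seteqP; split => x /=; rewrite !in_itv /= ltrBlDr lerBrDr.
rewrite !lebesgue_measure_itv /= !lte_fin ltrD2r; case: ifP => // _.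
by rewrite -!EFinB; congr EFin; lra.
Qed.

Section Cylinders.
Variable R : realType.
Local Notation lambda := (@lebesgue_measure R).
Local Notation U := (@unit_itv R).

Lemma measurable_unit_itv : measurable U.
Proof.
rewrite (_ : U = `[0, 1[%classic); first exact: measurable_itv.
by apply/seteqP; split => x /=; rewrite in_itv.
Qed.

Lemma lebesgue_unit_itv : lambda U = 1%E.
Proof.
rewrite (_ : U = `[0, 1[%classic); last by apply/seteqP; split => x /=; rewrite in_itv.
by rewrite lebesgue_measure_itv /= lte_fin ltr01 -EFinB subr0.
Qed.

Lemma measurable_dyadic K i : measurable (U `&` dyadic K @^-1` [set i]).
Proof.
rewrite (_ : _ `&` _ = U `&` `[i%:R / 2 ^+ K, i.+1%:R / 2 ^+ K[%classic).
  by apply: measurableI; [exact: measurable_unit_itv|exact: measurable_itv].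
have P0 : 0 < 2 ^+ K :> R by rewrite exprn_gt0.
apply/seteqP; split => x [Ux] /=; rewrite in_itv /= ler_pdivrMr // ltr_pdivlMr //;
  rewrite ![x * _]mulrC.
  by move=> <-; split => //; apply: dyadic_itv; case/andP: Ux.
by move=> h; split => //; exact: dyadic_uniq.
Qed.

Lemma measurable_bit k v : measurable (U `&` [set x | bits x k = v]).
Proof.
exact: (@measurable_preimage_pred _ _ nat (dyadic k.+1) U [set i | odd i = v]
  (measurable_dyadic k.+1)).
Qed.

(** Overwriting a digit is a translation on each of the two sets where that digit is constant; this
    is what makes the digits independent. *)
Lemma bits_update k (v : bool) (x : R) : U x ->
  let y := x + ((v%:R - (bits x k)%:R) / 2 ^+ k.+1) in
  U y /\ bits y = (fun j => if j == k then v else bits x j).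
Proof.
move=> Ux; set z := fun j => _.
have t : tail_eq k.+1 (bits x) z by move=> j kj; rewrite /z gtn_eqF.
have [y Uy yz] := bits_surj_tail Ux t.
rewrite -yz in t; have := tail_eq_diff Ux Uy t.
rewrite yz /= {1 2}/z eqxx (@eq_prefix_val z (bits x)); last first.
  by move=> j jk; rewrite /z ltn_eqF.
rewrite !natrD opprD addrACA subrr add0r => yx.
by rewrite -yx addrC subrK.
Qed.

Definition cyl (v : bool) (s : seq nat) : set R :=
  U `&` [set x | all (fun k => bits x k == v) s].

Lemma measurable_cyl v s : measurable (cyl v s).
Proof.
elim: s => [|k s ih].
  rewrite (_ : cyl v [::] = U); first exact: measurable_unit_itv.
  by apply/seteqP; split => x // [].
rewrite (_ : cyl v _ = (U `&` [set x | bits x k = v]) `&` cyl v s).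
  by apply: measurableI => //; exact: measurable_bit.
apply/seteqP; split => x; first by move=> [Ux /= /andP[/eqP ? ?]].
by move=> [[Ux xv] [_ xs]]; split => //=; rewrite xs andbT; apply/eqP.
Qed.

(** By induction: for [k] outside [s], the translation by [2^(-k-1)] carries the part of the
    cylinder with digit [k] equal to 0 onto the part where it is 1, so each new condition halves the
    measure. *)
Lemma lebesgue_cyl v s : uniq s -> lambda (cyl v s) = (2 ^- size s)%:E.
Proof.
elim: s => [|k s ih] /=.
  move=> _; rewrite expr0 invr1 (_ : cyl v [::] = U); first exact: lebesgue_unit_itv.
  by apply/seteqP; split => x // [].
move=> /andP[ks us]; have {}ih := ih us.
pose A w := cyl v s `&` (U `&` [set x | bits x k = w]).
have mA w : measurable (A w).
  by apply: measurableI; [exact: measurable_cyl|exact: measurable_bit].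
have upd (w : bool) x : cyl v s x -> cyl v s (x + ((w%:R - (bits x k)%:R) / 2 ^+ k.+1)).
  move=> [Ux /allP xs]; have [Uy ybits] := bits_update k w Ux.
  split => //=; rewrite ybits; apply/allP => j js.
  by case: (j =P k) => [jk|_]; [rewrite -jk js in ks|exact: xs].
have shift : A false = (fun x => x + 2 ^- k.+1) @^-1` A true.
  apply/seteqP; split => x [xs [Ux /= xk]].
    have := upd true _ xs; have [] := bits_update k true Ux.
    by rewrite xk subr0 mul1r => Uy yb ys; split => //; split => //=; rewrite yb eqxx.
  have := upd false _ xs; have [] := bits_update k false Ux.
  rewrite xk sub0r mulN1r addrK => Uy yb ys; split => //; split => //=.
  by rewrite yb eqxx.
have eqA : lambda (A false) = lambda (A true).
  by rewrite shift lebesgue_measure_shift.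
have sum : lambda (cyl v s) = (lambda (A false) + lambda (A true))%E.
  rewrite -measureU //.
    congr (lambda _); rewrite /A -setIUr setIidl // => x [Ux _].
    by case E : (bits x k); [right|left].
  - exact: mA.
  - exact: mA.
  by apply/seteqP; split => // x [[_ [_ /= xf]] [_ [_ /=]]]; rewrite xf.
have cylE : cyl v (k :: s) = A v.
  apply/seteqP; split => x /=; first by move=> [Ux /= /andP[/eqP ? ?]].
  by move=> [[Ux xs] [_ /= xk]]; split => //=; rewrite xk eqxx.
have half w : lambda (A w) = lambda (A true) by case: w.
rewrite cylE; move: sum; rewrite ih eqA half.
case: (lambda (A true)) => [r| |] //= [] h; congr EFin.
by rewrite exprS invfM h; lra.
Qed.

Lemma lebesgue_arith_bits M r v : (0 < M)%N ->
  lambda (\bigcap_j cyl v [:: r + j * M]%N) = 0%E.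
Proof.
move=> M0.
have mI : measurable (\bigcap_j cyl v [:: r + j * M]%N).
  by apply: bigcapT_measurable => j; exact: measurable_cyl.
have le N : (lambda (\bigcap_j cyl v [:: r + j * M]%N) <= (2 ^- N)%:E)%E.
  have -> : (2 ^- N)%:E = lambda (cyl v [seq (r + j * M)%N | j <- iota 0 N]).
    rewrite lebesgue_cyl ?size_map ?size_iota // map_inj_uniq ?iota_uniq //.
    by move=> i j; nia.
  apply: le_measure; rewrite ?inE //; first exact: measurable_cyl.
  move=> x h; split; first by case: (h 0%N I).
  apply/allP => _ /mapP[j _ ->].
  by have [_ /=] := h j I; rewrite andbT.
apply/eqP; rewrite eq_le measure_ge0 andbT; apply/lee_addgt0Pr => e e0.
rewrite add0e; apply: (le_trans (le (Num.trunc e^-1).+1)); rewrite lee_fin.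
rewrite invf_ple ?posrE ?exprn_gt0 //; apply: (le_trans (ltW (truncnS_gt _))).
by rewrite -natrX ler_nat; exact/ltnW/ltn_expl.
Qed.

(** An index [(M, r, v)] stands for the progression of offset [r] and modulus [M + 1], which is thus
    positive, along which all digits equal [v]. *)
Definition bad_pts : set R := \bigcup_(i : nat * nat * bool)
  \bigcap_j cyl i.2 [:: i.1.2 + j * i.1.1.+1]%N.

Definition good_pts : set R := U `&` [set x | good (bits x)].

Lemma good_ptsE : good_pts = U `\` bad_pts.
Proof.
apply/seteqP; split => x [Ux /= gx]; split => //.
  move=> [[[M r] v] _ /= h]; have [j xj] := gx M.+1 r (~~ v) isT.
  by have [_ /=] := h j I; rewrite xj andbT; case: (v).
move=> M r v M0; apply: contrapT => no; apply: gx.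
exists (M.-1, r, ~~ v) => // j _; split => //=; rewrite prednK // andbT.
by apply/eqP; case E : (bits x _); case: v no => // no; exfalso; apply: no; exists j.
Qed.

Lemma measurable_bad : measurable bad_pts.
Proof.
apply: countable_bigcupT_measurable => [|i]; first exact: countableP.
by apply: bigcapT_measurable => j; exact: measurable_cyl.
Qed.

Lemma measurable_good_pts : measurable good_pts.
Proof.
rewrite good_ptsE; apply: measurableD; first exact: measurable_unit_itv.
exact: measurable_bad.
Qed.

Lemma lebesgue_bad_pts : lambda bad_pts = 0%E.
Proof.
pose F k := if @unpickle (nat * nat * bool)%type k is Some i
  then \bigcap_j cyl i.2 [:: i.1.2 + j * i.1.1.+1]%N else set0.
have mF k : measurable (F k).
  rewrite /F; case: unpickle => [i|]; last exact: measurable0.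
  by apply: bigcapT_measurable => j; exact: measurable_cyl.
apply/eqP; rewrite eq_le measure_ge0 andbT.
apply: (le_trans (measure_sigma_subadditive lambda mF measurable_bad _)).
  by move=> x [i _ h]; exists (pickle i) => //; rewrite /F pickleK.
rewrite eseries0 // => k _ _; rewrite /F; case: unpickle => [i|]; last exact: measure0.
exact: lebesgue_arith_bits.
Qed.

Lemma lebesgue_good_pts_gt0 : (0 < lambda good_pts)%E.
Proof.
rewrite lt0e measure_ge0 andbT; apply/eqP => g0.
have : (lambda U <= lambda (good_pts `|` bad_pts))%E.
  apply: le_measure; rewrite ?inE; first exact: measurable_unit_itv.
    by apply: measurableU; [exact: measurable_good_pts|exact: measurable_bad].
  by move=> x Ux; rewrite good_ptsE; have [h|h] := pselect (bad_pts x); [right|left].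
rewrite lebesgue_unit_itv leNgt => /negP; apply.
have : (lambda (good_pts `|` bad_pts) <= lambda good_pts + lambda bad_pts)%E.
  by apply: measureU2; [exact: measurable_good_pts|exact: measurable_bad].
by rewrite g0 lebesgue_bad_pts adde0 => /le_lt_trans; apply.
Qed.

End Cylinders.

(** * Piecewise translations *)

Lemma measure_partition (d : measure_display) (T : measurableType d)
    (R : realType) (mu : {measure set T -> \bar R}) (I : countType) (D : set T)
    (c : T -> I) :
  measurable D -> (forall i, measurable (D `&` c @^-1` [set i])) ->
  (mu D = \sum_(0 <= n <oo) mu (D `&` (pickle \o c) @^-1` [set n]))%E.
Proof.
move=> mD mc.
have mcn n : measurable (D `&` (pickle \o c) @^-1` [set n]).
  exact: (@measurable_preimage_pred _ _ _ c D [set i | pickle i = n]).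
rewrite -[LHS]mul1e -integral_cst // (@ge0_integral_partition _ _ _ mu D (pickle \o c)) //.
by apply: eq_eseriesr => n _; rewrite integral_cst // mul1e.
Qed.

Section ImageMeasure.
Variables (R : realType) (T0 : pointedType) (f : T0 -> R).
Hypothesis f_inj : injective f.
Hypothesis f_range : measurable (range f).
Local Notation T := (g_sigma_algebra_preimageType f).

Lemma preimage_image_inj (A : set T0) : f @^-1` (f @` A) = A.
Proof.
apply/seteqP; split => [x /= [y Ay /f_inj <-] //|x Ax]; by exists x.
Qed.

Lemma measurable_image (A : set T) : measurable A <-> measurable (f @` A).
Proof.
split => [[B mB]|mfA]; last first.
  by exists (f @` A) => //; rewrite setTI preimage_image_inj.
rewrite setTI => <-; rewrite (_ : f @` _ = B `&` range f); first exact: measurableI.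
apply/seteqP; split => [_ [x /= Bx <-]|y [/= By [x _ xE]]]; first by split => //; exists x.
by exists x => //=; rewrite xE.
Qed.

Lemma standard_borel_preimage : standard_borel R T.
Proof. by exists f; split; [exact: f_inj|split; [|exact: measurable_image]]. Qed.

(** Lebesgue measure pulled back along [f]. The two proofs are arguments so that the measure
    structure can be attached to this very term. *)
Definition image_measure (_ : injective f) (_ : measurable (range f)) (A : set T) :
  \bar R := lebesgue_measure (f @` A).

Local Notation mu := (image_measure f_inj f_range).

Let mu0 : mu set0 = 0%E.
Proof. by rewrite /image_measure image_set0 measure0. Qed.

Let mu_ge0 A : (0 <= mu A)%E.
Proof. exact: measure_ge0. Qed.

Let mu_sigma_additive : semi_sigma_additive mu.
Proof.
move=> F mF tF mUF; rewrite /image_measure image_bigcup.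
apply: measure_semi_sigma_additive.
- by move=> n; exact/measurable_image.
- apply/trivIsetP => i j _ _ ij; apply/seteqP; split => // _ [[x Fx <-] [y Fy /f_inj yx]].
  have : (F i `&` F j) x by split => //; rewrite -yx.
  by move/trivIsetP : tF => /(_ i j I I ij) ->.
- by rewrite -image_bigcup; exact/measurable_image.
Qed.

HB.instance Definition _ := isMeasure.Build _ _ _ mu mu0 mu_ge0 mu_sigma_additive.

Section Translation.
Variables (I : countType) (phi psi : T -> T) (h : T -> I) (tau : I -> R).
Hypothesis phiK : cancel phi psi.
Hypothesis psiK : cancel psi phi.
Hypothesis phiE : forall t, f (phi t) = f t + tau (h t).
Hypothesis mh : forall i, measurable (h @^-1` [set i] : set T).

Let piece (A : set T) i :
  f @` (h @^-1` [set i] `&` phi @^-1` A) =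
  f @` (h @^-1` [set i]) `&` (fun x => x + tau i) @^-1` (f @` A).
Proof.
apply/seteqP; split => [_ [t [/= hi At] <-]|_ [[t /= hi <-] [s As]]].
  by split; [exists t|exists (phi t) => //; rewrite phiE hi].
by rewrite -hi -phiE => /f_inj sE; exists t => //; split => //=; rewrite -sE.
Qed.

Let piece_measurable (A : set T) i : measurable A ->
  measurable (h @^-1` [set i] `&` phi @^-1` A).
Proof.
move=> mA; apply/measurable_image; rewrite piece; apply: measurableI.
  exact/measurable_image.
rewrite -[X in measurable X]setTI; apply: measurable_addr => //.
exact/measurable_image.
Qed.

Lemma piecewise_translation_measurable : measurable_fun setT phi.
Proof.
move=> _ A mA; rewrite setTI.
have -> : phi @^-1` A = \bigcup_i (h @^-1` [set i] `&` phi @^-1` A).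
  by apply/seteqP; split => [t At|t [i _ []//]]; exists (h t).
apply: countable_bigcupT_measurable => [|i]; first exact: countableP.
exact: piece_measurable.
Qed.

Let image_piece (A : set T) i :
  f @` (h @^-1` [set i] `&` phi @^-1` A) =
  (fun x => x + tau i) @^-1` (f @` (A `&` psi @^-1` (h @^-1` [set i]))).
Proof.
rewrite piece; apply/seteqP; split => [_ [[t /= hi <-] [s As sE]]|x [s [As /= hs] sE]].
  exists s => //; split => //=.
  by move: sE; rewrite -hi -phiE => /f_inj ->; rewrite phiK.
split => /=; last by exists s.
by exists (psi s) => //; apply: (addIr (tau i)); rewrite -sE -hs -phiE psiK.
Qed.

Let back_measurable (A : set T) i : measurable A ->
  measurable (A `&` psi @^-1` (h @^-1` [set i])).
Proof.
move=> mA; apply/measurable_image.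
have -> : f @` (A `&` psi @^-1` (h @^-1` [set i])) =
    (fun x => x - tau i) @^-1` (f @` (h @^-1` [set i] `&` phi @^-1` A)).
  rewrite image_piece; apply/seteqP; split => x /=; by rewrite subrK.
rewrite -[X in measurable X]setTI; apply: measurable_addr => //.
by apply/measurable_image; exact: piece_measurable.
Qed.

(** The preimage of [A] is cut by [h] and [A] itself by [h \o psi]. Translation by [tau i] matches
    the pieces of index [i], and Lebesgue measure is translation invariant. *)
Lemma piecewise_translation_preserves (A : set T) : measurable A ->
  mu (phi @^-1` A) = mu A.
Proof.
move=> mA.
have mphi : measurable (phi @^-1` A).
  by rewrite -[X in measurable X]setTI; exact: piecewise_translation_measurable.
rewrite (@measure_partition _ _ _ mu I (phi @^-1` A) h) //; last first.
  by move=> i; apply: measurableI.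
rewrite [RHS](@measure_partition _ _ _ mu I A (h \o psi)) //; last first.
  by move=> i; exact: back_measurable.
apply: eq_eseriesr => n _.
have [[i <-]|nl] := pselect (exists i : I, pickle i = n); last first.
  have E0 (B : set T) (g : T -> I) : B `&` (pickle \o g) @^-1` [set n] = set0.
    by apply/seteqP; split => // x [_ /= xk]; apply: nl; exists (g x).
  by rewrite !E0.
have pE (g : T -> I) : (pickle \o g) @^-1` [set pickle i] = g @^-1` [set i].
  by apply/seteqP; split => x /=; [move=> /(pcan_inj pickleK)|move=> ->].
rewrite !pE [phi @^-1` A `&` _]setIC /= /image_measure image_piece lebesgue_measure_shift //.
by apply/measurable_image; exact: back_measurable.
Qed.

End Translation.
End ImageMeasure.

(** * The coupling *)

Section Points.
Variable R : realType.
Local Notation PT := (set_type (@good_pts R)).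

Lemma pt_unit (x : PT) : unit_itv (val x).
Proof. by have [] := set_valP x. Qed.

Lemma pt_ge0 (x : PT) : 0 <= val x.
Proof. by have /andP[] := pt_unit x. Qed.

Lemma pt_good (x : PT) : good (bits (val x)).
Proof. by have [] := set_valP x. Qed.

Lemma pt_bits_inj (x y : PT) : bits (val x) = bits (val y) -> x = y.
Proof. by move=> xy; apply: val_inj; exact: (bits_inj (pt_unit x) (pt_unit y) xy). Qed.

Lemma pt_surj_tail K (x : PT) z : tail_eq K (bits (val x)) z ->
  exists y : PT, bits (val y) = z.
Proof.
move=> t; have [y Uy yz] := bits_surj_tail (pt_unit x) t.
have gy : y \in @good_pts R.
  by rewrite inE; split => //=; rewrite yz; exact: good_tail_eq t (pt_good x).
by exists (SigSub gy).
Qed.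

Definition pt_odometer n (g : Zn n) (x y : PT) : Prop :=
  odometer g (bits (val x)) (bits (val y)).

Definition pt_act n (g : Zn n) (x : PT) : PT := xget x [set y | pt_odometer g x y].

(** The cocycle of the orbit relation: applied in dimension [a] to [x] and its image under [Z^b], it
    rewrites a move of one odometer as a move of the other. *)
Definition pt_diff n (x y : PT) : Zn n := xget 0 [set g | pt_odometer g x y].

Section Dim.
Variable n : nat.
Hypothesis n0 : (0 < n)%N.
Implicit Types g : Zn n.

Lemma pt_actP g x : pt_odometer g x (pt_act g x).
Proof.
have [z xz] := odometer_ex g n0 (pt_good x).
have [K t] := odometer_tail_eq xz; have [y yz] := pt_surj_tail t.
by rewrite /pt_act; case: xgetP => [//|/(_ y)]; rewrite /= /pt_odometer yz.
Qed.

Lemma pt_act_uniq g x y : pt_odometer g x y -> pt_act g x = y.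
Proof. by move=> h; apply: pt_bits_inj; exact: (odometer_inj n0 (pt_actP g x) h). Qed.

Lemma pt_act0 x : pt_act (0 : Zn n) x = x.
Proof. by apply: pt_act_uniq; exact: odometer_refl. Qed.

Lemma pt_actD g h x : pt_act (g + h) x = pt_act g (pt_act h x).
Proof.
apply: pt_act_uniq; rewrite addrC.
exact: (odometer_trans (pt_actP h x) (pt_actP g _)).
Qed.

Lemma pt_act_tail g x : exists K, tail_eq K (bits (val x)) (bits (val (pt_act g x))).
Proof. exact: odometer_tail_eq (pt_actP g x). Qed.

Lemma pt_diff_uniq g x y : pt_odometer g x y -> pt_diff n x y = g.
Proof.
move=> h; rewrite /pt_diff; case: xgetP => [k _ hk|/(_ g)//].
exact: odometer_elt_uniq hk h.
Qed.

Lemma pt_diffP K x y : tail_eq K (bits (val x)) (bits (val y)) ->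
  pt_odometer (pt_diff n x y) x y.
Proof.
by move=> t; have [g h] := tail_eq_odometer_ex n0 t; rewrite (pt_diff_uniq h).
Qed.

Lemma pt_diff_add K K' x y z : tail_eq K (bits (val x)) (bits (val y)) ->
  tail_eq K' (bits (val y)) (bits (val z)) ->
  pt_diff n x z = pt_diff n x y + pt_diff n y z.
Proof.
move=> t t'; apply: pt_diff_uniq.
exact: odometer_trans (pt_diffP t) (pt_diffP t').
Qed.

End Dim.

(* The action of [g] modifies a prefix of the digits in a way that depends on
   that prefix only. *)
Lemma pt_act_local n m (g : Zn n) K (x x0 : PT) : (0 < n)%N -> (0 < m)%N ->
  dyadic K (val x) = dyadic K (val x0) ->
  tail_eq K (bits (val x0)) (bits (val (pt_act g x0))) ->
  val (pt_act g x) - val x = val (pt_act g x0) - val x0 /\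
  pt_diff m x (pt_act g x) = pt_diff m x0 (pt_act g x0).
Proof.
move=> n0 m0 xx0 t0; set y0 := pt_act g x0 in t0 *.
have bx := dyadic_eq_bits (pt_ge0 x) (pt_ge0 x0) xx0.
pose z k := if (k < K)%N then bits (val y0) k else bits (val x) k.
have tz : tail_eq K (bits (val x)) z by move=> k Kk; rewrite /z ltnNge Kk.
have [y yz] := pt_surj_tail tz; rewrite -yz in tz.
have by0 k : (k < K)%N -> bits (val y) k = bits (val y0) k by move=> kK; rewrite yz /z kK.
have -> : pt_act g x = y.
  exact: (pt_act_uniq n0 (odometer_local n0 t0 bx by0 tz (pt_actP n0 g x0))).
split; last first.
  exact: (pt_diff_uniq (odometer_local m0 t0 bx by0 tz (pt_diffP m0 t0))).
rewrite (tail_eq_diff (pt_unit x) (pt_unit y) tz).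
rewrite (tail_eq_diff (pt_unit x0) (pt_unit y0) t0).
by rewrite (eq_prefix_val bx) (eq_prefix_val by0).
Qed.

End Points.

Section Space.
Variables (R : realType) (a b : nat) (pt : set_type (@good_pts R)).
Hypotheses (a0 : (0 < a)%N) (b0 : (0 < b)%N).
Local Notation PT := (set_type (@good_pts R)).

Definition cpl_pointed : pointedType :=
  HB.pack (PT * Zn a)%type (isPointed.Build (PT * Zn a)%type (pt, 0)).

(** Each [l] in [Z^a] gets its own copy of the good points, placed in the unit interval starting at
    [pickle l]. *)
Definition emb (t : cpl_pointed) : R := val t.1 + (pickle t.2)%:R.

Lemma emb_inj : injective emb.
Proof.
have tr t : Num.trunc (emb t) = pickle t.2.
  apply: truncn_def; have := pt_unit t.1; rewrite /emb /unit_itv /= -natr1; lra.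
move=> t u tu; have := tr t; rewrite tu tr => /(pcan_inj pickleK) tu2.
move: tu; rewrite /emb tu2 => /addIr /val_inj tu1.
by case: t u tu1 tu2 {tr} => [? ?] [? ?] /= -> ->.
Qed.

Lemma emb_fiber (l : Zn a) (B : set R) :
  emb @` [set t | t.2 = l /\ B (val t.1)] =
  (fun x => x - (pickle l)%:R) @^-1` (@good_pts R `&` B).
Proof.
apply/seteqP; split => [_ [t [/= <- Bt] <-]|x [/= gx Bx]].
  by rewrite /= /emb addrK; split => //; exact: set_valP.
have gx' : x - (pickle l)%:R \in @good_pts R by rewrite inE.
by exists (SigSub gx', l) => //=; rewrite /emb /= subrK.
Qed.

Lemma measurable_shift (B : set R) (r : R) : measurable B ->
  measurable ((fun x => x - r) @^-1` B).
Proof. by move=> mB; rewrite -[X in measurable X]setTI; exact: measurable_addr. Qed.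

Lemma emb_range : measurable (range emb).
Proof.
have -> : range emb = \bigcup_(l : Zn a)
    ((fun x => x - (pickle l)%:R) @^-1` (@good_pts R `&` setT)).
  apply/seteqP; split => [_ [t _ <-]|x [l _]]; last first.
    by rewrite -emb_fiber => -[t _ <-]; exists t.
  by exists t.2 => //; rewrite -emb_fiber; exists t.
apply: countable_bigcupT_measurable => [|l]; first exact: countableP.
by apply: measurable_shift; rewrite setIT; exact: measurable_good_pts.
Qed.

Definition cpl := g_sigma_algebra_preimageType emb.

Definition cpl_mu : {measure set cpl -> \bar R} := image_measure emb_inj emb_range.

Lemma measurable_fiber (l : Zn a) (B : set R) : measurable (@unit_itv R `&` B) ->
  measurable ([set t | t.2 = l /\ B (val t.1)] : set cpl).
Proof.
move=> mB; apply/(measurable_image emb_inj emb_range); rewrite emb_fiber.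
apply: measurable_shift; rewrite (_ : _ `&` _ = @good_pts R `&` (@unit_itv R `&` B)).
  by apply: measurableI => //; exact: measurable_good_pts.
by apply/seteqP; split => [x [gx Bx]|x [gx [_ Bx]]] //; split => //; split => //; case: gx.
Qed.

(** The coupling attached to an orbit equivalence: [Z^b] acts by its odometer and shifts the second
    coordinate by the cocycle, while [Z^a] only translates that coordinate. The minus sign makes the
    cocycle on [cplX] equal to [pt_diff]. *)
Definition cplG (g : Zn b) (t : cpl) : cpl :=
  (pt_act g t.1, t.2 - pt_diff a t.1 (pt_act g t.1)).

Definition cplL (l : Zn a) (t : cpl) : cpl := (t.1, t.2 + l).

Definition cplX : set cpl := [set t | t.2 = 0].

Lemma cplG0 t : cplG 0 t = t.
Proof.
rewrite /cplG pt_act0 // (pt_diff_uniq (odometer_refl _ _)) subr0.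
by case: t.
Qed.

Lemma cplGD g h t : cplG (g + h) t = cplG g (cplG h t).
Proof.
rewrite /cplG pt_actD //=; congr pair.
have [K t1] := pt_act_tail b0 h t.1.
have [K' t2] := pt_act_tail b0 g (pt_act h t.1).
by rewrite (pt_diff_add a0 t1 t2) opprD addrA.
Qed.

Lemma cplL0 t : cplL 0 t = t.
Proof. by case: t => x l; rewrite /cplL addr0. Qed.

Lemma cplLD g h t : cplL (g + h) t = cplL g (cplL h t).
Proof. by rewrite /cplL /= -addrA [h + g]addrC. Qed.

Lemma cplL_mp : mp_free_action cpl_mu cplL.
Proof.
have KL l : cancel (cplL l) (cplL (- l)) by move=> t; rewrite -cplLD addNr cplL0.
have LK l : cancel (cplL (- l)) (cplL l) by move=> t; rewrite -cplLD subrr cplL0.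
have mh (i : Zn a) : measurable ((fun t => t.2) @^-1` [set i] : set cpl).
  have := @measurable_fiber i setT; rewrite setIT => /(_ (@measurable_unit_itv R)).
  by congr measurable; apply/seteqP; split => t //= [].
have E l t : emb (cplL l t) = emb t + ((pickle (t.2 + l))%:R - (pickle t.2)%:R).
  by rewrite /emb /cplL /=; lra.
split.
- exact: cplL0.
- exact: cplLD.
- move=> l; exact: (piecewise_translation_measurable emb_inj emb_range
    (tau := fun i => (pickle (i + l))%:R - (pickle i)%:R) (E l) mh).
- move=> l; exact: (piecewise_translation_preserves emb_inj emb_range
    (tau := fun i => (pickle (i + l))%:R - (pickle i)%:R) (KL l) (LK l) (E l) mh).
- move=> l [x i] []; rewrite -[in X in _ = X](addr0 i) => /addrI.
  by [].
Qed.

Lemma cplG_mp : mp_free_action cpl_mu cplG.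
Proof.
have KG g : cancel (cplG g) (cplG (- g)) by move=> t; rewrite -cplGD addNr cplG0.
have GK g : cancel (cplG (- g)) (cplG g) by move=> t; rewrite -cplGD subrr cplG0.
(* The displacement on the line is a dyadic rational plus an integer, so its values in [rat] index
   countably many pieces. *)
pose h g t := xget (0 : rat) [set q | emb (cplG g t) - emb t = ratr q].
have hP g t : emb (cplG g t) - emb t = ratr (h g t).
  rewrite /h; case: xgetP => // no; exfalso.
  have [K tl] := pt_act_tail b0 g t.1.
  pose y := pt_act g t.1; pose d := pt_diff a t.1 y.
  apply: (no ((((prefix_val (bits (val y)) K)%:R - (prefix_val (bits (val t.1)) K)%:R)
    / 2 ^+ K) + (pickle (t.2 - d))%:R - (pickle t.2)%:R)) => /=.
  have := tail_eq_diff (pt_unit t.1) (pt_unit y) tl.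
  rewrite !(rmorphD, rmorphN, rmorphM, fmorphV, rmorphXn, rmorph_nat) /emb /= -/y -/d => yE.
  by rewrite rmorph1 (_ : 1 + 1 = 2 :> R) // -yE; lra.
have hE g t : emb (cplG g t) = emb t + ratr (h g t) by rewrite -hP; lra.
have mh g (q : rat) : measurable (h g @^-1` [set q] : set cpl).
  (* Call a dyadic interval in a copy admissible if it contains a point displaced by [q] whose
     digits from [K] on are unchanged. By [pt_act_local] the whole interval is then displaced by
     [q], so the fibre is a countable union of such intervals. *)
  pose W (i : nat * nat * Zn a) := exists t : cpl,
    [/\ h g t = q, dyadic i.1.1 (val t.1) = i.1.2, t.2 = i.2 &
      tail_eq i.1.1 (bits (val t.1)) (bits (val (pt_act g t.1)))].
  have -> : h g @^-1` [set q] = \bigcup_i (if `[<W i>] then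
      [set t | t.2 = i.2 /\ dyadic i.1.1 (val t.1) = i.1.2] else set0).
    apply/seteqP; split => [t /= hq|t [[[K i] l] _]].
      have [K tl] := pt_act_tail b0 g t.1.
      exists (K, dyadic K (val t.1), t.2) => //.
      by case: asboolP => // -[]; exists t.
    case: asboolP => // -[t0 /= [hq dt0 t0l tl]] [tl' dt] /=.
    rewrite -hq /h.
    suff -> : emb (cplG g t) - emb t = emb (cplG g t0) - emb t0 by [].
    have [vE dE] := pt_act_local b0 a0 (etrans dt (esym dt0)) tl.
    by move: vE; rewrite /emb /cplG /= tl' t0l dE; lra.
  apply: countable_bigcupT_measurable => [|[[K i] l]]; first exact: countableP.
  case: asboolP => // _ /=; apply: (@measurable_fiber l [set x | dyadic K x = i]).
  exact: measurable_dyadic.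
split.
- exact: cplG0.
- exact: cplGD.
- move=> g; exact: (piecewise_translation_measurable emb_inj emb_range
    (tau := ratr) (hE g) (mh g)).
- move=> g; exact: (piecewise_translation_preserves emb_inj emb_range
    (tau := ratr) (KG g) (GK g) (hE g) (mh g)).
- move=> g t [] /(congr1 fst) /= tt.
  have := pt_actP b0 g t.1; rewrite tt => h1.
  exact: odometer_elt_uniq h1 (odometer_refl _ _).
Qed.

Lemma cpl_actC g l t : cplG g (cplL l t) = cplL l (cplG g t).
Proof. by rewrite /cplG /cplL /= addrAC. Qed.

Lemma measurable_cplX : measurable cplX.
Proof.
have := @measurable_fiber 0 setT; rewrite setIT => /(_ (@measurable_unit_itv R)).
by congr measurable; apply/seteqP; split => t //= [].
Qed.

Lemma cplL_fund : fund_domain cplL cplX.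
Proof.
split; first exact: measurable_cplX.
move=> t; exists (- t.2); split => [|l]; rewrite /cplX /= ?subrr //.
by move=> /eqP; rewrite addrC addr_eq0 => /eqP ->.
Qed.

(** A point [(x, l)] is sent into [cplX] exactly by those [g] that move [x] as [l] does in the
    [Z^a]-odometer. Both odometers have the classes of tail equality as orbits, which gives
    existence; freeness of the [Z^b]-odometer gives uniqueness. *)
Lemma cplG_fund : fund_domain cplG cplX.
Proof.
split; first exact: measurable_cplX.
move=> t; pose y := pt_act t.2 t.1.
have ty := pt_actP a0 t.2 t.1.
have [K tl] := pt_act_tail a0 t.2 t.1.
have [g gy] := tail_eq_odometer_ex b0 tl.
exists g; split => [|g']; rewrite /cplX /=.
  by rewrite (pt_act_uniq b0 gy) (pt_diff_uniq ty) subrr.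
move=> /eqP; rewrite subr_eq0 => /eqP tE.
have [K' tl'] := pt_act_tail b0 g' t.1.
have h1 := pt_diffP a0 tl'; rewrite -tE in h1.
have e := pt_act_uniq a0 h1.
apply: (odometer_elt_uniq gy); rewrite e; exact: pt_actP.
Qed.

Lemma cpl_cocycle g t : cplX t ->
  cocycle cplG cplL cplX g t = pt_diff a t.1 (pt_act g t.1).
Proof.
move=> /= t2; apply: (return_elt_uniq cplL_fund).
by rewrite /cplX /= t2 sub0r addNr.
Qed.

Lemma cpl_mu_fiber0 (B : set R) : measurable (@unit_itv R `&` B) ->
  cpl_mu (cplX `&` [set t | B (val t.1)]) = lebesgue_measure (@good_pts R `&` B).
Proof.
move=> mB; rewrite /cpl_mu /= /image_measure.
have -> : cplX `&` [set t | B (val t.1)] = [set t | t.2 = 0 /\ B (val t.1)] by [].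
rewrite emb_fiber lebesgue_measure_shift //.
rewrite (_ : _ `&` _ = @good_pts R `&` (@unit_itv R `&` B)).
  by apply: measurableI => //; exact: measurable_good_pts.
by apply/seteqP; split => [x [gx Bx]|x [gx [_ Bx]]] //; split => //; split => //; case: gx.
Qed.

End Space.

(** * Integrability estimates *)

Lemma integral_le_layers (d : measure_display) (T : measurableType d)
    (R : realType) (mu : {measure set T -> \bar R}) (D : set T) (w : T -> \bar R)
    (E : nat -> set T) (C : nat -> R) :
  measurable D -> measurable_fun D w -> (forall x, D x -> (0 <= w x)%E) ->
  (forall m, measurable (E m)) -> (forall m, 0 <= C m) ->
  (forall x, D x -> exists2 m, E m x & (w x <= (C m)%:E)%E) ->
  (\int[mu]_(x in D) w x <= \sum_(0 <= m <oo) (C m)%:E * mu (E m `&` D))%E.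
Proof.
move=> mD mw w0 mE C0 cover.
pose F m x := ((C m)%:E * (\1_(E m) x)%:E)%E : \bar R.
have F0 m x : (0 <= F m x)%E by rewrite mule_ge0 // lee_fin.
have mI m : measurable_fun D (fun x => (\1_(E m) x)%:E : \bar R).
  by apply/measurable_EFinP/measurable_funTS; exact: measurable_indic.
have mF m : measurable_fun D (F m).
  by apply: emeasurable_funM => //; exact: measurable_cst.
have mS : measurable_fun D (fun x => \sum_(0 <= m <oo) F m x)%E.
  have := @ge0_emeasurable_sum _ _ _ D F predT (fun k x _ _ => F0 k x) (fun k _ => mF k).
  by apply: eq_measurable_fun => x _; apply: eq_eseriesl.
rewrite (_ : (\sum_(0 <= m <oo) _)%E = \int[mu]_(x in D) \sum_(0 <= m <oo) F m x)%E.
  apply: ge0_le_integral => //.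
  move=> x Dx; have [m Ex wm] := cover x Dx.
  apply: (le_trans wm).
  have := @nneseries_lim_ge R (F ^~ x) xpredT 0 m.+1 (fun n _ _ => F0 n x).
  apply: le_trans; rewrite big_nat_recr //= {2}/F indicE mem_set // mule1.
  by rewrite leeDr // sume_ge0.
rewrite integral_nneseries //; apply: eq_eseriesr => m _.
by rewrite ge0_integralZl_EFin // ?integral_indic // => x _; rewrite lee_fin.
Qed.

Lemma geometric_eseries_fin (R : realType) (K theta : R) (u : nat -> \bar R) :
  0 <= K -> 0 < theta < 1 -> (forall m, (0 <= u m <= (K * theta ^+ m)%:E)%E) ->
  (\sum_(0 <= m <oo) u m < +oo)%E.
Proof.
move=> K0 /andP[th0 th1] hu.
apply: (@le_lt_trans _ _ (K / (1 - theta))%:E); last by rewrite ltey.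
apply: lime_le.
  by apply: is_cvg_nneseries => n _ _; have /andP[] := hu n.
apply: nearW => n.
apply: (@le_trans _ _ (\sum_(0 <= i < n) (K * theta ^+ i)%:E)%E).
  by apply: lee_sum => i _; have /andP[] := hu i.
rewrite sumEFin lee_fin; have := @geometric_le_lim R n K theta K0 th0.
by rewrite ger0_norm ?(ltW th0) // => /(_ th1).
Qed.

Section Integrability.
Variables (R : realType) (b : nat).
Hypothesis b0 : (0 < b)%N.
Local Notation PT := (set_type (@good_pts R)).
Local Notation U := (@unit_itv R).
Local Notation lambda := (@lebesgue_measure R).

(** The points having a coordinate whose digits are constant on the levels from [s] to [m - 1], so
    that a carry may fail to be absorbed there. *)
Definition missed (s m : nat) : set R := \bigcup_(iv : 'I_b * bool)
  cyl iv.2 [seq (j * b + iv.1)%N | j <- iota s (m - s)].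

Lemma measurable_missed s m : measurable (missed s m).
Proof.
apply: countable_bigcupT_measurable => [|i]; first exact: countableP.
exact: measurable_cyl.
Qed.

(** There are [2 b] cylinders, each fixing [m - s] digits; when [m < s] the truncated subtraction
    still respects the bound. *)
Lemma lebesgue_missed s m : (lambda (missed s m) <= (b.*2%:R * 2 ^+ s / 2 ^+ m)%:E)%E.
Proof.
have := @measure_le_sum_cover _ _ _ lambda _ (index_enum ('I_b * bool)%type)
  (fun iv => cyl iv.2 [seq (j * b + iv.1)%N | j <- iota s (m - s)]) _
  (measurable_missed s m) (fun iv => measurable_cyl _ _).
move=> /(_ _)/le_trans; apply.
  by move=> x [iv _ h]; rewrite (bigD1 iv) //=; left.
have cE (iv : 'I_b * bool) :
    lambda (cyl iv.2 [seq (j * b + iv.1)%N | j <- iota s (m - s)]) =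
    (2 ^- (m - s))%:E.
  rewrite lebesgue_cyl ?size_map ?size_iota // map_inj_uniq ?iota_uniq // => i j; nia.
apply: (@le_trans _ _ (\sum_(iv : 'I_b * bool) (2 ^- (m - s))%:E)%E).
  apply: lee_sum => iv _; have := lexx (2 ^- (m - s) : R)%:E%E.
  by rewrite -{1}(cE iv).
rewrite sumEFin sumr_const card_prod card_ord card_bool muln2.
rewrite lee_fin -[leLHS]mulr_natl -mulrA ler_wpM2l //.
have P0 j : 0 < 2 ^+ j :> R by rewrite exprn_gt0.
rewrite ler_pdivlMr // mulrC ler_pdivrMr // -exprD ler_eXn2l ?ltr1n //; lia.
Qed.

Lemma missedPn s m (x : R) : U x -> ~ missed s m x ->
  forall (i : 'I_b) v, exists j, [/\ (s <= j)%N, (j < m)%N & bits x (j * b + i)%N = v].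
Proof.
move=> Ux nmiss i v; apply: contrapT => no; apply: nmiss.
exists (i, ~~ v) => //; split => //=; apply/allP => _ /mapP[j + ->].
rewrite mem_iota => jr; rewrite -[_ == _]negbK; apply/negP => jv.
apply: no; exists j; split; [lia|lia|].
by move: jv; case: (bits _ _) v => -[].
Qed.

Lemma good_not_missed s (x : PT) : exists m, ~ missed s m (val x).
Proof.
have ex (iv : 'I_b * bool) : exists j, bits (val x) (s * b + iv.1 + j * b)%N = ~~ iv.2.
  exact: pt_good.
have [f Hf] := choice ex.
exists (s + (\max_iv f iv).+1)%N => -[iv _ [_ /= /allP h]].
have /h : ((s + f iv) * b + iv.1)%N \in
    [seq (j * b + iv.1)%N | j <- iota s (s + (\max_iv f iv).+1 - s)].
  apply/mapP; exists (s + f iv)%N => //.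
  by rewrite mem_iota; have := leq_bigmax (F := f) iv; lia.
rewrite (_ : ((s + f iv) * b + iv.1)%N = (s * b + iv.1 + f iv * b)%N); last by lia.
by rewrite Hf; case: iv.2.
Qed.

Variable a : nat.
Hypothesis a0 : (0 < a)%N.

(** Outside [missed s m] only the first [m * b] digits change. They fit into [(m * b) %/ a + 1]
    levels of the [Z^a]-odometer, where [tail_eq_odometer] bounds the move. *)
Lemma wordlen_pt_diff (s m : nat) (g : Zn b) (x : PT) :
  (forall i, (`|g ord0 i| <= 2 ^ s)%N) -> ~ missed s m (val x) ->
  (wordlen (pt_diff a x (pt_act g x)) <= a * 2 ^ ((m * b) %/ a).+1)%N.
Proof.
move=> gs nmiss.
have [z xz] := odometer_at_ex b0 gs (missedPn (pt_unit x) nmiss).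
have [t _] := xz; have [y yz] := pt_surj_tail t.
have -> : pt_act g x = y by apply: (pt_act_uniq b0); rewrite /pt_odometer yz; exists m.
rewrite -yz in t.
have [|l hl] := @tail_eq_odometer a ((m * b) %/ a).+1 (bits (val x)) (bits (val y)).
  by apply: tail_eq_le t; exact/ltnW/ltn_ceil.
have xy : pt_odometer l x y by exists ((m * b) %/ a).+1.
by rewrite (pt_diff_uniq xy).
Qed.

Lemma layer_const_le (p : R) m : 0 < p ->
  (a * 2 ^ ((m * b) %/ a).+1)%:R `^ p <=
  (a * 2)%:R `^ p * (2 `^ (b%:R * p / a%:R)) ^+ m.
Proof.
move=> p0; have aR : 0 < a%:R :> R by rewrite ltr0n.
rewrite expnS mulnA natrM powRM // ler_wpM2l ?powR_ge0 //.
rewrite -powR_mulrn ?powR_ge0 // -powRrM natrX -powR_mulrn // -powRrM.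
apply: ler_powR; first by rewrite ler1n.
have : (((m * b) %/ a)%N%:R * a%:R : R) <= m%:R * b%:R.
  by rewrite -!natrM ler_nat leq_trunc_div.
rewrite -ler_pdivlMr // => h.
apply: (le_trans (ler_wpM2r (ltW p0) h)).
by rewrite le_eqVlt; apply/orP; left; apply/eqP; field; rewrite gt_eqF.
Qed.

Lemma powR2_lt2 (r : R) : r < 1 -> 2 `^ r < 2 :> R.
Proof.
move=> r1; rewrite -[ltRHS]powRr1 // /powR pnatr_eq0 /= ltr_expR ltr_pM2r //.
by rewrite ln_gt0 // ltr1n.
Qed.

End Integrability.

(** * Existence below the critical exponent *)

Theorem coupling_exists (R : realType) (a b : nat) (p : R) :
  (0 < a)%N -> (0 < b)%N -> 0 < p -> p < a%:R / b%:R -> exists_LpL0_coupling p b a.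
Proof.
move=> a0 b0 p0 pab.
have [x0 gx0] : exists x, @good_pts R x.
  apply: contrapT => no; have := lebesgue_good_pts_gt0 R.
  rewrite (_ : @good_pts R = set0) ?measure0 ?ltxx //.
  by apply/seteqP; split => // x gx; apply: no; exists x.
pose pt : set_type (@good_pts R) := SigSub (mem_set gx0).
pose X := @cplX R a pt.
have muXB B : measurable (@unit_itv R `&` B) ->
  cpl_mu a pt (X `&` [set t | B (val t.1)]) = lebesgue_measure (@good_pts R `&` B).
  exact: cpl_mu_fiber0.
have muX : cpl_mu a pt X = lebesgue_measure (@good_pts R).
  have XE : X `&` [set t | setT (val t.1)] = X by apply/seteqP; split => t //= [].
  by have := muXB setT; rewrite XE !setIT; apply; exact: measurable_unit_itv.
have mX : measurable X := measurable_cplX a pt.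
have muX1 : (cpl_mu a pt X <= 1)%E.
  rewrite muX -(lebesgue_unit_itv R); apply: le_measure; rewrite ?inE.
  - exact: measurable_good_pts.
  - exact: measurable_unit_itv.
  - by move=> x [].
have muXoo : (cpl_mu a pt X < +oo)%E by rewrite (le_lt_trans muX1) // ltey.
have Gmp := cplG_mp pt a0 b0; have Lmp := @cplL_mp R a pt.
have LX := cplL_fund a pt; have GX := cplG_fund pt a0 b0.
exists _, (cpl a pt), (cpl_mu a pt), (@cplG R a b pt), (@cplL R a pt), X, X.
split.
- split; first exact: (standard_borel_preimage (@emb_inj R a pt) (emb_range a pt)).
  apply: (@lt_le_trans _ _ (cpl_mu a pt X)); first by rewrite muX lebesgue_good_pts_gt0.
  by apply: le_measure; rewrite ?inE.
- by split.
- exact: cpl_actC.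
- by split.
move=> g.
have mw : measurable_fun X (fun x =>
    (((wordlen (cocycle (@cplG R a b pt) (@cplL R a pt) X g x))%:R : R) `^ p)%:E).
  apply: measurable_funTS; apply: (@measurable_fun_countable _ _ _ _ (Zn a)
    (fun x => cocycle (@cplG R a b pt) (@cplL R a pt) X g x) setT
    (fun l => (((wordlen l)%:R : R) `^ p)%:E)).
  move=> l; rewrite setTI.
  exact: (act_preimage_measurable Gmp g (return_elt_measurable Lmp LX l)).
apply/integrableP; split => //.
have [s gs] := exp2_ge_all g.
(* A point is assigned to the least level [m] at which it is not missed. It is then missed at level
   [m - 1], whence the shift of index and the whole of [X] at level 0. *)
pose E m : set (cpl a pt) :=
  if m is m'.+1 then X `&` [set t | missed b s m' (val t.1)] else X.
pose C m : R := (a * 2 ^ ((m * b) %/ a).+1)%:R `^ p.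
have mUmiss m : measurable (@unit_itv R `&` missed b s m).
  by apply: measurableI; [exact: measurable_unit_itv|exact: measurable_missed].
have mE m : measurable (E m).
  by case: m => [|m] //; exact: (measurable_fiber pt 0 (mUmiss m)).
have cover t : X t -> exists2 m, E m t &
    (`|(((wordlen (cocycle (@cplG R a b pt) (@cplL R a pt) X g t))%:R : R) `^ p)%:E|
      <= (C m)%:E)%E.
  move=> Xt; have [m0 nm0] := good_not_missed b0 s t.1.
  have ex : exists m, `[<~ missed b s m (val t.1)>] by exists m0; apply/asboolP.
  case: (ex_minnP ex) => m /asboolP nm mmin; exists m.
    case: m nm mmin => [//|m] _ mmin; split => //=; apply: contrapT => nm.
    by have := mmin m; rewrite ltnn => /(_ _)/negP; apply=> //; apply/asboolP.
  rewrite gee0_abs ?lee_fin ?powR_ge0 //; apply: ge0_ler_powR; rewrite ?nnegrE //.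
    exact: ltW.
  rewrite ler_nat cpl_cocycle //.
  exact: (wordlen_pt_diff b0 a0 gs nm).
have := @integral_le_layers _ _ _ (cpl_mu a pt) X _ E C mX
  (measurableT_comp (@abse_measurable R setT) mw) (fun x _ => abse_ge0 _) mE _ cover.
move=> /(_ (fun m => powR_ge0 _ _)) /le_lt_trans; apply.
(* The bounds [C m] grow like [rho^m] while the layers shrink like [2^(-m)]; the condition
   [p < a / b] says exactly that [rho < 2]. *)
pose rho : R := 2 `^ (b%:R * p / a%:R).
have rho0 : 0 < rho by rewrite powR_gt0.
have rho2 : rho < 2.
  apply: powR2_lt2; rewrite ltr_pdivrMr ?ltr0n // mul1r mulrC.
  by rewrite -ltr_pdivlMr // ltr0n.
(* The last factor 2 compensates for the shift of index in [E], and [Q >= 1] covers level 0. *)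
pose Q : R := b.*2%:R * 2 ^+ s * 2.
have Q1 : 1 <= Q.
  have h1 : 1 <= b.*2%:R :> R by rewrite ler1n double_gt0.
  have h2 : 1 <= 2 ^+ s :> R by rewrite exprn_ege1 // ler1n.
  by rewrite /Q; nra.
have muE m : (cpl_mu a pt (E m `&` X) <= (Q / 2 ^+ m)%:E)%E.
  case: m => [|m].
    by rewrite setIid expr0 divr1 (le_trans muX1) // lee_fin.
  rewrite (setIidl (_ : E m.+1 `<=` X)); last by move=> t [].
  rewrite (muXB (missed b s m)) //.
  apply: (@le_trans _ _ (lebesgue_measure (missed b s m))).
    apply: le_measure; rewrite ?inE; last by move=> x [].
      rewrite (_ : _ `&` _ = @good_pts R `&` (@unit_itv R `&` missed b s m)).
        by apply: measurableI; [exact: measurable_good_pts|exact: mUmiss].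
      apply/seteqP; split => [x [gx Bx]|x [gx [_ Bx]]] //; split => //; split => //.
      by case: gx.
    exact: measurable_missed.
  apply: (le_trans (lebesgue_missed R b0 s m)); rewrite lee_fin /Q exprS.
  rewrite invfM mulrACA mulrA -[leRHS]mulrA le_eqVlt; apply/orP; left; apply/eqP.
  by field; rewrite expf_neq0 ?pnatr_eq0.
apply: (@geometric_eseries_fin R ((a * 2)%:R `^ p * Q) (rho / 2)).
- by rewrite mulr_ge0 ?powR_ge0 // (le_trans _ Q1).
- by rewrite divr_gt0 //= ltr_pdivrMr // mul1r.
move=> m; rewrite mule_ge0 ?lee_fin ?powR_ge0 //=.
apply: (@le_trans _ _ ((C m)%:E * (Q / 2 ^+ m)%:E)%E).
  by apply: lee_wpmul2l; [rewrite lee_fin powR_ge0|exact: muE].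
rewrite -EFinM lee_fin exprMn exprVn.
rewrite [leRHS]mulrACA.
apply: ler_wpM2r; first by rewrite divr_ge0 ?exprn_ge0 // (le_trans _ Q1).
exact: layer_const_le.
Qed.

Theorem theorem4p4 (R : realType) (a b : nat) (p : R) :
  (0 < a)%N -> (a < b)%N -> 0 < p ->
  exists_LpL0_coupling p b a <-> p < a%:R / b%:R.
Proof.
move=> a0 ab p0; split => [cpl|pab].
  rewrite ltNge; apply/negP => qp.
  exact: (no_critical_coupling a0 ab qp cpl).
by apply: coupling_exists => //; exact: ltn_trans ab.
Qed.
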